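(* Fix $1/2<\alpha\le2/3$ and let $\omega^\alpha_+(x)=\frac{1}{|x|\,|\log|x||^\alpha}\chi_{B^+(0;1/3)}(x)$. For each integer $n\ge2$ define $\omega^n_+$ on $\mathbb{R}^2$ by $\omega^n_+(x)=0$ if $x_2<0$, and for $x_2\ge0$: $\omega^n_+(x)=\omega^\alpha_+(x)$ if $|x|>1/n$, and $\omega^n_+(x)=\frac{n}{|\log n|^\alpha}$ if $|x|\le1/n$. Then $\omega^n_+\to\omega^\alpha_+$ strongly in $L^2(\log L)^\kappa(\mathbb{R}^2)$ as $n\to\infty$, for every $0\le\kappa<\alpha-1/2$. Moreover, if $u^n_1$ denotes the first component of $K\ast\omega^n_+$, then \[\lim_{n\to\infty}\int_{\mathbb{R}^2}u^n_1|\omega^n_+|^2\,dx=+\infty.\]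
   Context: $B^+(0;1/3)=\{x\in\mathbb{R}^2:|x|<1/3,\ x_2>0\}$; $K(x)=\frac{x^\perp}{2\pi|x|^2}$, $(x_1,x_2)^\perp=(-x_2,x_1)$. For $\kappa\ge0$, $A_{2,\kappa}(s)=[s\log^\kappa(2+s)]^2$, $L^2(\log L)^\kappa=\{f\in L^1_{loc}:\int A_{2,\kappa}(|f|)<\infty\}$ with Luxemburg norm $\|f\|_{2,\kappa}=\inf\{k>0:\int A_{2,\kappa}(|f|/k)\le1\}$. *)

(* Defs.v *)
From HB Require Import structures.
From mathcomp Require Import all_boot all_order all_algebra.
From mathcomp Require Import all_classical all_reals all_analysis.
Set Implicit Arguments. Unset Strict Implicit. Unset Printing Implicit Defensive.
Import Order.TTheory GRing.Theory Num.Theory.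
Import numFieldNormedType.Exports.
Local Open Scope classical_set_scope.
Local Open Scope ring_scope.

Section Defs.
Variable R : realType.

Definition leb2 : set (R * R) -> \bar R :=
  ((@lebesgue_measure R) \x (@lebesgue_measure R))%E.

Definition enorm2 (x : R * R) : R := Num.sqrt (x.1 ^+ 2 + x.2 ^+ 2).

Definition Bplus : set (R * R) := [set x | enorm2 x < 3^-1 /\ 0 < x.2].

Definition omega_alpha (alpha : R) (x : R * R) : R :=
  if `[< Bplus x >] then (enorm2 x * (`|ln (enorm2 x)| `^ alpha))^-1 else 0.

Definition omega_n (alpha : R) (n : nat) (x : R * R) : R :=
  if x.2 < 0 then 0
  else if (n%:R)^-1 < enorm2 x then omega_alpha alpha x
  else n%:R / (`|ln n%:R| `^ alpha).

Definition A2k (kappa s : R) : R := (s * (ln (2 + s) `^ kappa)) ^+ 2.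

Definition in_L2logL (kappa : R) (f : R * R -> R) : Prop :=
  (\int[leb2]_x (A2k kappa `|f x|)%:E < +oo)%E.

(* Luxemburg norm inf{k > 0 : int A_{2,kappa}(|f|/k) <= 1}, in \bar R
   (= +oo if the set is empty). *)
Definition lux_norm (kappa : R) (f : R * R -> R) : \bar R :=
  ereal_inf [set k%:E | k in
    [set k : R | 0 < k /\ (\int[leb2]_x (A2k kappa (`|f x| / k))%:E <= 1)%E]].

(* Biot-Savart kernel K(z) = z^perp / (2 pi |z|^2), z^perp = (-z_2, z_1);
   its first component: *)
Definition K1 (z : R * R) : R := - z.2 / (2 * pi * enorm2 z ^+ 2).

Definition u1 (w : R * R -> R) (x : R * R) : R :=
  Rintegral leb2 setT (fun y => K1 (x.1 - y.1, x.2 - y.2) * w y).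

End Defs.

(* Main.v *)
(**
Everything is done without polar coordinates.  The function
[1 / (r^2 |ln r|^b)] is dominated near the origin by a series of multiples of
indicators of the squares of side [2^-k], whose integrals form the series of
[k^-b]; it is therefore integrable for [b > 1].  With [b = 2 (alpha - kappa)] it
dominates the Young function of [omega_alpha], and as [omega_n <= omega_alpha]
off the axis with equality outside the disc of radius [1/n], dominated
convergence gives the strong convergence.

For the divergence, the negative part of the integrand of [u1 x] lives in the
strip [0 < y.2 < x.2].  With [h = x.2 - y.2], bound [omega_n y] by [1/|y|] and
split the product of [h / |x - y|^2] and [1/|y|] by AM-GM with weight
[sqrt (h / y.2)]: integrating in [y.1] leaves [pi / sqrt (h y.2)], whose integral
over [0 < y.2 < x.2] is at most [pi^2], whatever [x] and [n].  So
[u1 >= - pi / 2].  The positive part is bounded from below on the disjoint boxes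
[]0, 2^-k-1] x ]2^-k-1, 2^-k]]: for [x] in box [m], each box [k <= m - 3]
contributes at least a multiple of [(m+1)^-alpha], hence
[u1 x >= c (m+1)^(1-alpha) - pi / 2].  Integrating against [omega_n^2], box [m]
contributes at least a multiple of [(m+1)^(1 - 3 alpha) >= (m+1)^-1], and the
harmonic series diverges.
*)

Require Import Defs.
From HB Require Import structures.
From mathcomp Require Import all_boot all_order all_algebra.
From mathcomp Require Import all_classical all_reals all_analysis.
From mathcomp Require Import measurable_realfun ring lra.
Import Order.TTheory GRing.Theory Num.Theory.
Import numFieldNormedType.Exports.
Local Open Scope classical_set_scope.
Local Open Scope ring_scope.

(** * Comparison of integrals *)

(* No measurability is needed: the integral of a nonnegative function is a
   supremum over the simple functions below it. *)
Lemma le_integralT (d : measure_display) (T : measurableType d) (R : realType)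
    (mu : {measure set T -> \bar R}) (f g : T -> \bar R) :
  (forall x, f x <= g x)%E -> (\int[mu]_x f x <= \int[mu]_x g x)%E.
Proof.
move=> fg; rewrite /integral.
apply: leeB; apply: ereal_sup_le => _ [h hf <-]; exists h => // x;
  apply: (le_trans (hf x)).
- by rewrite !funeposE !patchE !in_setT ge_max !le_max lexx fg !orbT.
- by rewrite !funenegE !patchE !in_setT ge_max !le_max lexx leeN2 fg !orbT.
Qed.

(** The function [h], infinite on [N] and zero elsewhere, has integral zero, and [f <= g + h] holds
    everywhere. *)
Lemma le_integral_off_null (d : measure_display) (T : measurableType d) (R : realType)
    (mu : {measure set T -> \bar R}) (N : set T) (f g : T -> \bar R) :
  measurable N -> mu N = 0%E -> measurable_fun setT g -> (forall x, 0 <= g x)%E ->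
  (forall x, ~ N x -> f x <= g x)%E -> (\int[mu]_x f x <= \int[mu]_x g x)%E.
Proof.
move=> mN N0 mg g0 fg.
pose h := cst +oo%E \_ N : T -> \bar R.
have mh : measurable_fun setT h by apply/(measurable_restrictT _ mN).1; exact: measurable_cst.
have h0 x : (0 <= h x)%E by rewrite /h patchE; case: ifP => _; rewrite ?leey.
have ih : (\int[mu]_x h x = 0)%E.
  by rewrite /h -integral_mkcond integral_cst// N0 mule0.
rewrite -[leRHS]adde0 -ih -ge0_integralD//.
apply: le_integralT => x; rewrite /h patchE.
case: ifPn => [_|].
  by rewrite addey ?leey// gt_eqF// (lt_le_trans _ (g0 x)).
by move=> /negP; rewrite inE => /fg; rewrite adde0.
Qed.

(** * Improper integrals bounded through an antiderivative *)

Section FTC_le.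
Context {R : realType}.
Local Notation mu := (@lebesgue_measure R).

(** Monotone convergence along the growing compact intervals, on each of which the fundamental
    theorem of calculus applies. This covers the whole line and open intervals at whose ends [f]
    blows up. *)
Lemma ge0_integral_FTC_le (f F : R -> R) (a b : nat -> R) (M : R) :
  (forall n, a n < b n) -> (forall n, a n.+1 <= a n) -> (forall n, b n <= b n.+1) ->
  (forall n x, a n <= x <= b n ->
     [/\ 0 <= f x, {for x, continuous f} & is_derive x 1 F (f x)]) ->
  (forall n, F (b n) - F (a n) <= M) ->
  (\int[mu]_(x in \bigcup_n `[a n, b n]%classic) (f x)%:E <= M%:E)%E.
Proof.
move=> ab an bn fF FM.
have cf n : {within `[a n, b n], continuous f}.
  apply: continuous_in_subspaceT => x; rewrite inE/= in_itv/= => /fF[_ + _]; exact.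
have mfn n : measurable_fun `[a n, b n] f.
  by apply: subspace_continuous_measurable_fun.
have an' : nonincreasing_seq a by apply/nonincreasing_seqP.
have bn' : nondecreasing_seq b by apply/nondecreasing_seqP.
pose I n := `[a n, b n]%classic.
have ndI : nondecreasing_seq I.
  move=> m n mn; rewrite subsetEset => x /=; rewrite /I/= !in_itv/= => /andP[ax xb].
  by rewrite (le_trans (an' _ _ mn))//= (le_trans xb)// bn'.
have mI n : measurable (I n) by exact: measurable_itv.
have mfI n : measurable_fun (I n) (EFin \o f) by apply/measurable_EFinP; exact: mfn.
have f0I n x : I n x -> (0 <= (EFin \o f) x)%E.
  by rewrite /I/= in_itv/= => /fF[f0 _ _]; rewrite lee_fin.
have /cvg_lim <-// : (\int[mu]_(x in I n) (EFin \o f) x)%E @[n --> \oo] -->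
    (\int[mu]_(x in \bigcup_n I n) (EFin \o f) x)%E.
  exact: (@ge0_nondecreasing_set_cvg_integral _ (measurableTypeR R) R I (EFin \o f) mu ndI mI mfI f0I).
apply: lime_le.
  apply: ereal_nondecreasing_is_cvgn.
  exact: (@ge0_nondecreasing_set_nondecreasing_integral _ (measurableTypeR R) R I
    (EFin \o f) mu ndI mI mfI f0I).
apply: nearW => n.
have dF x : a n <= x <= b n -> is_derive x 1 F (f x) by move=> /fF[].
have cF x : a n <= x <= b n -> {for x, continuous F}.
  move=> /dF ?; apply: differentiable_continuous; apply/derivable1_diffP.
  exact: ex_derive.
rewrite (@continuous_FTC2 _ f F)//.
- by rewrite -EFinB lee_fin.
- split.
  + by move=> x; rewrite in_itv/= => /andP[/ltW ? /ltW ?]; have := dF x; move=> /(_ _)[]//; apply/andP.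
  + by apply: cvg_at_right_filter; apply: cF; rewrite lexx ltW.
  + by apply: cvg_at_left_filter; apply: cF; rewrite lexx ltW.
- move=> x; rewrite in_itv/= => /andP[/ltW ? /ltW ?]; rewrite derive1E.
  by apply: derive_val; apply: dF; apply/andP.
Qed.
End FTC_le.

(** * Planar Lebesgue measure and Tonelli's theorem *)

Section leb2_measure.
Context {R : realType}.
Local Notation mu := (@lebesgue_measure R).

Let leb2_0 : leb2 (@set0 (R * R)) = 0%E.
Proof. exact: (@measure0 _ _ _ (mu \x mu)%E). Qed.

Let leb2_ge0 (A : set (R * R)) : (0 <= leb2 A)%E.
Proof. exact: (@measure_ge0 _ _ _ (mu \x mu)%E). Qed.

Let leb2_sigma_additive : semi_sigma_additive (@leb2 R : set (R * R) -> \bar R).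
Proof. exact: (@measure_semi_sigma_additive _ _ _ (mu \x mu)%E). Qed.

(** [leb2] unfolds to the product measure; registering it as a measure under its own name makes the
    integration lemmas apply to integrals against [leb2]. *)
HB.instance Definition _ := isMeasure.Build _ _ _ (@leb2 R)
  leb2_0 leb2_ge0 leb2_sigma_additive.

Import HBNNSimple.
Let S : measurableType _ := (R * R)%type.
Let T : measurableType _ := (measurableTypeR R * measurableTypeR R)%type.

Let nnsfun_ST (h : {nnsfun S >-> R}) :
  exists2 h' : {nnsfun T >-> R}, (h' : T -> R) = h &
    sintegral (mu \x mu)%E h' = sintegral (@leb2 R) h.
Proof.
pose m1 := @isMeasurableFun.Build _ _ T R h (@measurable_funP _ _ _ _ _ h).
pose m2 := @FiniteImage.Build _ _ (h : T -> R) (@fimfunP _ _ h).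
pose m3 := @isNonNegFun.Build _ _ (h : T -> R) (@fun_ge0 _ _ h).
pose h' : {nnsfun T >-> R} := HB.pack (h : T -> R) m1 m2 m3.
by exists h'.
Qed.

Let nnsfun_TS (h : {nnsfun T >-> R}) :
  exists2 h' : {nnsfun S >-> R}, (h' : S -> R) = h &
    sintegral (@leb2 R) h' = sintegral (mu \x mu)%E h.
Proof.
pose m1 := @isMeasurableFun.Build _ _ S R h (@measurable_funP _ _ _ _ _ h).
pose m2 := @FiniteImage.Build _ _ (h : S -> R) (@fimfunP _ _ h).
pose m3 := @isNonNegFun.Build _ _ (h : S -> R) (@fun_ge0 _ _ h).
pose h' : {nnsfun S >-> R} := HB.pack (h : S -> R) m1 m2 m3.
by exists h'.
Qed.

(* The two sides are integrals over measurable types that have the same carrier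
   and the same measurable sets but different displays. *)
Lemma leb2_integralE (f : R * R -> \bar R) :
  (\int[@leb2 R]_z f z = \int[mu \x mu]_z f z)%E.
Proof.
rewrite /integral; congr (ereal_sup _ - ereal_sup _)%E; apply/seteqP; split.
- by move=> _ [h hf <-]; have [h' h'h <-] := nnsfun_ST h; exists h' => // x; rewrite h'h.
- by move=> _ [h hf <-]; have [h' h'h <-] := nnsfun_TS h; exists h' => // x; rewrite h'h.
- by move=> _ [h hf <-]; have [h' h'h <-] := nnsfun_ST h; exists h' => // x; rewrite h'h.
- by move=> _ [h hf <-]; have [h' h'h <-] := nnsfun_TS h; exists h' => // x; rewrite h'h.
Qed.

Lemma leb2_rect (A B : set R) : measurable A -> measurable B ->
  leb2 (A `*` B) = (mu A * mu B)%E.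
Proof. by move=> mA mB; rewrite /leb2 product_measure1E. Qed.

Lemma leb2_integral_iter (f : R * R -> \bar R) : measurable_fun setT f ->
  (forall z, 0 <= f z)%E ->
  (\int[@leb2 R]_z f z = \int[mu]_y \int[mu]_x f (x, y))%E.
Proof. by move=> mf f0; rewrite leb2_integralE fubini_tonelli2. Qed.

Lemma leb2_axis : leb2 [set z : R * R | z.2 = 0] = 0%E.
Proof.
rewrite (_ : mkset _ = setT `*` [set 0]); last by apply/seteqP; split => z //= [].
by rewrite leb2_rect// lebesgue_measure_set1 mule0.
Qed.

Lemma measurable_axis : measurable [set z : R * R | z.2 = 0].
Proof.
rewrite (_ : mkset _ = setT `*` [set 0]); last by apply/seteqP; split => z //= [].
exact: measurableX.
Qed.

(** On the axis near the origin [omega_n] is positive while [omega_alpha] vanishes, so comparisons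
    between them can only be asked for off this null line. *)
Lemma leb2_le_integral_off_axis (f g : R * R -> \bar R) :
  measurable_fun setT g -> (forall z, 0 <= g z)%E ->
  (forall z : R * R, z.2 != 0 -> (f z <= g z)%E) ->
  (\int[@leb2 R]_z f z <= \int[@leb2 R]_z g z)%E.
Proof.
move=> mg g0 fg; apply: (le_integral_off_null _ _ _ _ _ _ _ measurable_axis leb2_axis) => // z.
by move=> /eqP; exact: fg.
Qed.
End leb2_measure.

(** * The Poisson and arcsine integrals *)

Section one_dim.
Context {R : realType}.
Local Notation mu := (@lebesgue_measure R).

(** An antiderivative is [atan ((s - c) / a) / a], and [atan] has total variation [pi]. This
    performs every integration in the horizontal variable. *)
Lemma integral_poisson_le (c a : R) : 0 < a ->
  (\int[mu]_s (((c - s) ^+ 2 + a ^+ 2)^-1)%:E <= (pi / a)%:E)%E.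
Proof.
move=> a0.
rewrite (_ : setT = \bigcup_n `[- (n.+1%:R), n.+1%:R]%classic); last first.
  apply/seteqP; split => // x _; exists (Num.truncn `|x|) => //=.
  rewrite in_itv/= -ler_norml; exact/ltW/truncnS_gt.
apply: (@ge0_integral_FTC_le _ _ (fun s => atan ((s - c) / a) / a)).
- by move=> n; rewrite gtrN.
- by move=> n; rewrite lerN2 ler_nat.
- by move=> n; rewrite ler_nat.
- move=> n x _.
  have h : 0 < (c - x) ^+ 2 + a ^+ 2 by rewrite ltr_wpDl ?sqr_ge0// exprn_gt0.
  split.
  + by rewrite invr_ge0 ltW.
  + apply: cvgV; first by rewrite gt_eqF.
    apply: cvgD; last exact: cvg_cst.
    apply: (@continuous_comp _ _ _ (fun s => c - s) (fun s : R => s ^+ 2)); last exact: exprn_continuous.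
    by apply: cvgB; [exact: cvg_cst|exact: cvg_id].
  + have -> : ((c - x) ^+ 2 + a ^+ 2)^-1 = a^-1 * (a^-1 * (1 + ((x - c) / a) ^+ 2)^-1).
      by rewrite -!invfM; congr _^-1; field; rewrite gt_eqF.
    have d1 : is_derive x 1 (fun s : R => (s - c) / a) a^-1.
      by apply: is_derive_eq; rewrite subr0 /GRing.scale/= mulr0 add0r mulr1.
    have d2 : is_derive x 1 (fun s : R => atan ((s - c) / a)) ((1 + ((x - c) / a) ^+ 2)^-1 * a^-1).
      exact: (is_derive1_comp (is_derive1_atan _) d1).
    by apply: is_derive_eq; rewrite /GRing.scale/= mulr0 add0r [_^-1 * a^-1]mulrC.
- move=> n.
  rewrite -mulrBl ler_pM2r ?invr_gt0//.
  have := @atan_ltpi2 R ((n.+1%:R - c) / a); have := @atan_gtNpi2 R ((- n.+1%:R - c) / a).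
  by lra.
Qed.

(** An antiderivative is [asin (2 t / X - 1)], which rises by [pi] from [t = 0] to [t = X]. This is
    the vertical integral left over in the estimate of the negative part of the velocity. *)
Lemma integral_arcsine_le (X : R) : 0 < X ->
  (\int[mu]_(t in `]0%R, X[) ((Num.sqrt (t * (X - t)))^-1)%:E <= pi%:E)%E.
Proof.
move=> X0.
(* The shift by 3 gives [3 e n <= X], so that [e n < X - e n] already for [n = 0]. *)
pose e (n : nat) := X / n.+3%:R.
have e0 n : 0 < e n by rewrite divr_gt0.
have eS n : e n.+1 <= e n by rewrite ler_pM2l// lef_pV2 ?posrE// ler_nat.
have eX n : e n * 3 <= X.
  by rewrite /e mulrAC ler_pdivrMr// ler_pM2l// ler_nat.
rewrite (_ : [set` _] = \bigcup_n `[e n, X - e n]%classic); last first.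
  apply/seteqP; split => [x|x [n _]]/=; rewrite !in_itv/=; last first.
    have e0n := e0 n; move=> /andP[h1 h2]; lra.
  move=> /andP[x0 xX].
  pose y := Num.min x (X - x).
  have y0 : 0 < y by rewrite lt_min x0 subr_gt0.
  exists (Num.truncn (X / y)) => //=; rewrite in_itv/=.
  have : e (Num.truncn (X / y)) <= y.
    rewrite /e ler_pdivrMr// mulrC -ler_pdivrMr//.
    by apply: (le_trans (ltW (truncnS_gt _))); rewrite ler_nat ltnS 2?leqW.
  by rewrite le_min => /andP[? ?]; lra.
apply: (@ge0_integral_FTC_le _ _ (fun t => asin (2 / X * t - 1))).
- by move=> n; have := e0 n; have := eX n; lra.
- exact: eS.
- by move=> n; have := eS n; lra.
- move=> n x /andP[h1 h2].
  have x0 : 0 < x by have := e0 n; lra.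
  have xX : 0 < X - x by have := e0 n; lra.
  have p0 : 0 < x * (X - x) by exact: mulr_gt0.
  split.
  + by rewrite invr_ge0 sqrtr_ge0.
  + apply: cvgV; first by rewrite gt_eqF// sqrtr_gt0.
    apply: (@continuous_comp _ _ _ (fun t : R => t * (X - t)) (fun t : R => Num.sqrt t));
      last exact: sqrt_continuous.
    by apply: cvgM; [exact: cvg_id|apply: cvgB; [exact: cvg_cst|exact: cvg_id]].
  + have d1 : is_derive x 1 (fun s : R => 2 / X * s - 1) (2 / X).
      by apply: is_derive_eq; rewrite subr0 /GRing.scale/= mulr1.
    have hb : -1 < 2 / X * x - 1 < 1.
      have : 0 < 2 / X * x by rewrite mulr_gt0// divr_gt0.
      have : 2 / X * x < 2 by rewrite mulrAC ltr_pdivrMr//; lra.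
      by lra.
    have := @is_derive1_comp R asin (fun s => 2 / X * s - 1) x _ _ (is_derive1_asin hb) d1.
    suff -> : (Num.sqrt (1 - (2 / X * x - 1) ^+ 2))^-1 * (2 / X) = (Num.sqrt (x * (X - x)))^-1 by [].
    rewrite (_ : 1 - _ = (2 / X) ^+ 2 * (x * (X - x))); last by field; rewrite gt_eqF.
    rewrite sqrtrM ?sqr_ge0// sqrtr_sqr gtr0_norm ?divr_gt0// invfM mulrAC mulVf ?mul1r//.
    by rewrite gt_eqF// divr_gt0.
- move=> n.
  have hb t : 0 < t < X -> -1 <= 2 / X * t - 1 <= 1.
    move=> /andP[t0 tX].
    have : 0 < 2 / X * t by rewrite mulr_gt0// divr_gt0.
    have : 2 / X * t < 2 by rewrite mulrAC ltr_pdivrMr//; lra.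
    by lra.
  have /hb/asin_geNpi2 ? : 0 < e n < X by have := e0 n; have := eX n; lra.
  have /hb/asin_lepi2 ? : 0 < X - e n < X by have := e0 n; have := eX n; lra.
  by lra.
Qed.
End one_dim.

(** * Convergence of the p-series *)

Section p_series.
Context {R : realType}.

(** A discrete integral comparison: [ln (1 - t) <= - t] at [t = 1/(k+2)] bounds
    [ln (k+2) - ln (k+1)] below by [1/(k+2)], and exponentiating [s] times this gives
    [1 + s/(k+2) <= ((k+2)/(k+1))^s]. *)
Lemma powRN_telescope (s : R) (k : nat) : 0 < s ->
  s * (k.+2%:R `^ (1 + s))^-1 <= (k.+1%:R `^ s)^-1 - (k.+2%:R `^ s)^-1.
Proof.
move=> s0.
have p1 : 0 < k.+1%:R `^ s :> R by rewrite powR_gt0.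
have p2 : 0 < k.+2%:R `^ s :> R by rewrite powR_gt0.
have k2 : 0 < k.+2%:R :> R by [].
have k1 : 0 < k.+1%:R :> R by [].
have lnk : k.+2%:R^-1 <= ln k.+2%:R - ln k.+1%:R :> R.
  rewrite -opprB -ln_div ?posrE// lerNr.
  have -> : k.+1%:R / k.+2%:R = 1 + - k.+2%:R^-1 :> R.
    have c0 : k.+2%:R != 0 :> R by rewrite pnatr_eq0.
    by apply: (mulIf c0); rewrite divfK// mulrDl mulNr mulVf// mul1r -[k.+2]addn1 natrD addrK.
  by apply: le_ln1Dx; rewrite ltrN2 invf_lt1// ltr1n.
have QP : 1 + s * k.+2%:R^-1 <= k.+2%:R `^ s / k.+1%:R `^ s.
  rewrite /powR !gt_eqF//= -expRB -mulrBr.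
  by apply: le_trans (expR_ge1Dx _); rewrite lerD2l ler_pM2l.
rewrite powRD ?pnatr_eq0 ?implybT// powRr1// -(ler_pM2r p2).
rewrite invfM mulrA divfK ?gt_eqF// mulrBl mulVf ?gt_eqF//.
by rewrite lerBrDl [leRHS]mulrC.
Qed.

Lemma nneseries_powRN_lty (b : R) : 1 < b ->
  (\sum_(k <oo) ((k.+1%:R `^ b)^-1)%:E < +oo)%E.
Proof.
move=> b1; pose s := b - 1.
have s0 : 0 < s by rewrite subr_gt0.
have bs : b = 1 + s by rewrite /s addrC subrK.
(* The subtracted term [(n+1)^-s] is what lets the induction telescope. *)
have h n : \sum_(0 <= k < n.+1) (k.+1%:R `^ b)^-1 <= 1 + s^-1 * (1 - (n.+1%:R `^ s)^-1) :> R.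
  elim: n => [|n ih]; first by rewrite big_nat1 !powR1 invr1 subrr mulr0 addr0.
  rewrite big_nat_recr//=; apply: (le_trans (lerD ih (lexx _))).
  have : (n.+2%:R `^ b)^-1 <= s^-1 * ((n.+1%:R `^ s)^-1 - (n.+2%:R `^ s)^-1).
    by rewrite mulrC ler_pdivlMr// mulrC bs powRN_telescope.
  lra.
apply: (@le_lt_trans _ _ (1 + s^-1)%:E); last exact: ltry.
apply: lime_le; first by apply: is_cvg_nneseries => n _ _; rewrite lee_fin invr_ge0 powR_ge0.
near=> n; rewrite sumEFin lee_fin -(@prednK n); last by near: n; exists 1%N.
apply: (le_trans (h _)).
by rewrite lerD2l ler_piMr ?invr_ge0 ?(ltW s0)// gerBl invr_ge0 powR_ge0.
Unshelve. all: by end_near. Qed.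
End p_series.

(** * Measurability of the functions involved *)

Section measurability.
Context {R : realType}.
Context {d : measure_display} {T : measurableType d}.
Implicit Types f : T -> R.

(** The inverse is rewritten as [f] times a real power of [f^2]; squaring takes care of negative
    values, and where [f] vanishes both sides are zero by the convention [0^-1 = 0]. *)
Lemma measurable_funV f : measurable_fun setT f -> measurable_fun setT (fun x => (f x)^-1).
Proof.
move=> mf; rewrite (_ : (fun x => _) = fun x => f x * (f x ^+ 2) `^ (-1)); last first.
  apply/funext => x; rewrite powR_inv1 ?sqr_ge0//.
  by have [->|f0] := eqVneq (f x) 0; [rewrite invr0 mul0r|field].
apply: measurable_funM => //.
apply: (@measurableT_comp _ _ _ _ _ _ (@powR R ^~ (-1))); first exact: measurable_powR.
exact: measurable_funX.
Qed.

Lemma measurable_fun_sqrt f : measurable_fun setT f ->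
  measurable_fun setT (fun x => Num.sqrt (f x)).
Proof.
apply: measurableT_comp; apply: continuous_measurable_fun.
exact: sqrt_continuous.
Qed.

Lemma measurable_fun_ln f : measurable_fun setT f ->
  measurable_fun setT (fun x => ln (f x)).
Proof. by apply: (@measurableT_comp _ _ _ _ _ _ (@ln R)); exact: measurable_ln. Qed.

Lemma measurable_fun_powR f p : measurable_fun setT f ->
  measurable_fun setT (fun x => f x `^ p).
Proof. by apply: (@measurableT_comp _ _ _ _ _ _ (@powR R ^~ p)); exact: measurable_powR. Qed.

Lemma measurable_fun_norm f : measurable_fun setT f ->
  measurable_fun setT (fun x => `|f x|).
Proof. by apply: (@measurableT_comp _ _ _ _ _ _ (fun x : R => `|x|)); exact: normr_measurable. Qed.

End measurability.

Section plane_measurability.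
Context {R : realType}.

Lemma measurable_enorm2 : measurable_fun setT (@enorm2 R).
Proof.
by apply: measurable_fun_sqrt; apply: measurable_funD; apply: measurable_funX.
Qed.

Lemma measurable_omega_alpha (alpha : R) : measurable_fun setT (omega_alpha alpha).
Proof.
rewrite (_ : omega_alpha alpha = fun x => if (enorm2 x < 3^-1) && (0 < x.2)
    then (enorm2 x * (`|ln (enorm2 x)| `^ alpha))^-1 else 0); last first.
  apply/funext => x; rewrite /omega_alpha /Bplus/=; congr (if _ then _ else _).
  by apply/asboolP/andP.
apply: measurable_fun_ifT => //.
  apply: measurable_and; apply: measurable_fun_ltr => //; exact: measurable_enorm2.
apply: measurable_funV; apply: measurable_funM; first exact: measurable_enorm2.
by apply: measurable_fun_powR; apply: measurable_fun_norm;
  apply: measurable_fun_ln; exact: measurable_enorm2.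
Qed.

Lemma measurable_omega_n (alpha : R) n : measurable_fun setT (omega_n alpha n).
Proof.
apply: measurable_fun_ifT => //; first exact: measurable_fun_ltr.
apply: measurable_fun_ifT => //.
  by apply: measurable_fun_ltr => //; exact: measurable_enorm2.
exact: measurable_omega_alpha.
Qed.

Lemma measurable_A2k (kappa : R) (f : R * R -> R) : measurable_fun setT f ->
  measurable_fun setT (fun x => A2k kappa (f x)).
Proof.
move=> mf; apply: measurable_funX; apply: measurable_funM => //.
by apply: measurable_fun_powR; apply: measurable_fun_ln; apply: measurable_funD.
Qed.

Lemma measurable_K1 (x : R * R) :
  measurable_fun setT (fun y : R * R => K1 (x.1 - y.1, x.2 - y.2)).
Proof.
have m2 : measurable_fun setT (fun y : R * R => x.2 - y.2) by apply: measurable_funB.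
apply: measurable_funM; first exact: measurable_funN.
apply: measurable_funV; apply: measurable_funM => //; apply: measurable_funX.
apply: measurable_fun_sqrt; apply: measurable_funD; apply: measurable_funX => //.
by apply: measurable_funB.
Qed.

End plane_measurability.

(** * Integrability of the radial majorant *)

Section radial.
Context {R : realType}.

(** The cutoff at 1/2 stays away from the zero of the logarithm at radius 1 and still contains the
    support of [omega_alpha], which lies within radius 1/3. *)
Definition radial_bound (b : R) (z : R * R) : R :=
  if 0 < enorm2 z < 2^-1 then (enorm2 z ^+ 2 * `|ln (enorm2 z)| `^ b)^-1 else 0.

Lemma radial_bound_ge0 b z : 0 <= radial_bound b z.
Proof. by rewrite /radial_bound; case: ifP => // _; rewrite invr_ge0 mulr_ge0 ?sqr_ge0 ?powR_ge0. Qed.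

Lemma measurable_radial_bound b : measurable_fun setT (radial_bound b).
Proof.
have mE := @measurable_enorm2 R.
apply: measurable_fun_ifT => //.
  by apply: measurable_and; apply: measurable_fun_ltr.
apply: measurable_funV; apply: measurable_funM; first exact: measurable_funX.
by apply: measurable_fun_powR; apply: measurable_fun_norm; apply: measurable_fun_ln.
Qed.

Lemma abs_le_enorm2 (z : R * R) : `|z.1| <= enorm2 z /\ `|z.2| <= enorm2 z.
Proof. by split; rewrite -sqrtr_sqr ler_wsqrtr// ?lerDl ?lerDr sqr_ge0. Qed.

Lemma enorm2_ge0 (z : R * R) : 0 <= enorm2 z.
Proof. exact: sqrtr_ge0. Qed.

Lemma sqr_enorm2 (z : R * R) : enorm2 z ^+ 2 = z.1 ^+ 2 + z.2 ^+ 2.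
Proof. by rewrite sqr_sqrtr// addr_ge0 ?sqr_ge0. Qed.

Lemma leb2_integral_indic (c : R) (A : set (R * R)) : 0 <= c -> measurable A ->
  (\int[@leb2 R]_z (c * \1_A z)%:E = c%:E * leb2 A)%E.
Proof.
move=> c0 mA; under eq_integral do rewrite EFinM.
rewrite ge0_integralZl_EFin//.
- by rewrite integral_indic// setIT.
- by apply/measurable_EFinP; exact: measurable_indic.
Qed.

Lemma dyadic_scale (r : R) : 0 < r < 2^-1 ->
  exists k : nat, 2^-1 ^+ k.+2 <= r < 2^-1 ^+ k.+1.
Proof.
move=> /andP[r0 r2].
have ex : exists k, 2^-1 ^+ k.+2 <= r.
  exists (Num.truncn r^-1).+1.
  rewrite exprVn invf_ple ?posrE ?exprn_gt0//; apply: (le_trans (ltW (truncnS_gt _))).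
  by rewrite -natrX ler_nat (leq_trans _ (ltnW (ltn_expl _ (isT : (1 < 2)%N))))// ltnS 2?leqW.
exists (ex_minn ex); case: ex_minnP => -[|k] hk min; rewrite hk//= ?expr1//.
by rewrite ltNge; apply/negP => /min; rewrite ltnn.
Qed.

Lemma integral_radial_bound_lty (b : R) : 1 < b ->
  (\int[@leb2 R]_z (radial_bound b z)%:E < +oo)%E.
Proof.
move=> b1.
pose q k : R := 2^-1 ^+ k.+1.
have q0 k : 0 < q k by rewrite exprn_gt0.
pose Q k : set (R * R) := `[- q k, q k]%classic `*` `[- q k, q k]%classic.
have mQ k : measurable (Q k) by apply: measurableX.
have lQ k : leb2 (Q k) = (4 * q k ^+ 2)%:E.
  rewrite leb2_rect// lebesgue_measure_itv/= lte_fin gtrN// -EFinB -EFinM; congr EFin.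
  by ring.
have ln2 : 0 < ln 2 :> R by rewrite ln_gt0// ltr1n.
(* An upper bound for [radial_bound] on the annulus [q k / 2 <= r < q k]: there
   [r^-2 <= 4 / q k ^ 2] and [|ln r| >= (k+1) ln 2]. *)
pose c k : R := 4 / q k ^+ 2 / (k.+1%:R * ln 2) `^ b.
have c0 k : 0 <= c k by rewrite !mulr_ge0 ?invr_ge0 ?sqr_ge0 ?powR_ge0.
pose F k (z : R * R) := (c k * \1_(Q k) z)%:E.
have mF k : measurable_fun setT (F k).
  by apply/measurable_EFinP; apply: measurable_funM => //; exact: measurable_indic.
have F0 k z : (0 <= F k z)%E by rewrite lee_fin mulr_ge0// indicE.
apply: (@le_lt_trans _ _ (\int[@leb2 R]_z (\sum_(k <oo) F k z))%E).
  apply: le_integralT => z.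
  rewrite /radial_bound; case: ifPn => [rz|_]; last exact: nneseries_ge0.
  have [k /andP[kr rk]] := dyadic_scale _ rz.
  have /andP[r0 r2] := rz.
  apply: (@le_trans _ _ (F k z)); last first.
    apply: (le_trans _ (@nneseries_lim_ge _ _ _ _ k.+1 _)) => //.
    by rewrite big_nat_recr//= leeDr// sume_ge0.
  have zQ : Q k z.
    have [h1 h2] := abs_le_enorm2 z.
    by split; rewrite /= in_itv/= -ler_norml ltW// (le_lt_trans _ rk).
  rewrite /F indicE mem_set// mulr1 lee_fin /c invfM.
  have lnk : k.+1%:R * ln 2 <= `|ln (enorm2 z)|.
    rewrite ler0_norm; last by rewrite ln_le0// ltW// (lt_trans r2)// invf_lt1// ltr1n.
    rewrite lerNr; have := ltW rk; rewrite -(@ler_ln _ (enorm2 z)) ?posrE ?exprn_gt0// => /le_trans; apply.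
    by rewrite lnXn// lnV ?posrE// mulNrn mulr_natl.
  apply: ler_pM; rewrite ?invr_ge0 ?sqr_ge0 ?powR_ge0//.
    have -> : 4 / q k ^+ 2 = ((q k / 2) ^+ 2)^-1 by field; rewrite gt_eqF.
    rewrite lef_pV2 ?posrE ?exprn_gt0// ?divr_gt0// ler_pXn2r// ?nnegrE ?(ltW r0) ?divr_ge0 ?(ltW (q0 _))//.
    by rewrite /q mulrC -exprS.
  have k0 : 0 < k.+1%:R * ln 2 :> R by rewrite mulr_gt0.
  rewrite lef_pV2 ?posrE ?powR_gt0//; last exact: lt_le_trans lnk.
  by rewrite ge0_ler_powR ?nnegrE ?(ltW k0) ?normr_ge0 ?(le_trans ler01 (ltW b1)).
rewrite integral_nneseries//.
(* The area [4 q k ^ 2] cancels the scale in [c k], leaving a multiple of the p-series with exponent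
   [b]. *)
under eq_eseriesr => k _.
  rewrite leb2_integral_indic// [leb2 _]lQ -EFinM.
  rewrite (_ : _ * _ = 16 / ln 2 `^ b * (k.+1%:R `^ b)^-1); last first.
    have := q0 k => ?; rewrite /c powRM ?(ltW ln2)// invfM.
    by field; rewrite !gt_eqF// powR_gt0.
  over.
rewrite /=; under eq_eseriesr do rewrite EFinM.
rewrite nneseriesZl; last by move=> k _; rewrite lee_fin invr_ge0 powR_ge0.
by rewrite lte_mul_pinfty ?lee_fin ?divr_ge0 ?powR_ge0// nneseries_powRN_lty.
Qed.
End radial.

(** * Pointwise bounds on the vorticities and on the Young function *)

Section omega_bounds.
Context {R : realType}.
Variable alpha : R.
Hypotheses (alpha_ge0 : 0 <= alpha) (alpha_le1 : alpha <= 1).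

Lemma powR_ge1 (x p : R) : 1 <= x -> 0 <= p -> 1 <= x `^ p.
Proof.
move=> x1 p0; have : 1 `^ p <= x `^ p by rewrite ge0_ler_powR ?nnegrE// (le_trans ler01).
by rewrite powR1.
Qed.

(** From [ln (6/5) >= 1/6] and [(6/5)^6 <= 3]. It gives [|ln r| >= 1] for all [0 < r < 1/3]. *)
Lemma ln3_ge1 : 1 <= ln 3 :> R.
Proof.
have h : 6^-1 <= ln (6 / 5) :> R.
  rewrite -[6 / 5]invrK lnV ?posrE ?invr_gt0 ?divr_gt0// lerNr.
  have -> : (6 / 5)^-1 = 1 + - 6^-1 :> R by field.
  by apply: le_ln1Dx; lra.
apply: (@le_trans _ _ (ln ((6 / 5) ^+ 6))).
  rewrite lnXn ?divr_gt0//; apply: (@le_trans _ _ (6^-1 *+ 6)); last by rewrite lerMn2r h.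
  by rewrite -[6^-1 *+ 6]mulr_natr; lra.
by rewrite ler_ln ?posrE ?exprn_gt0 ?divr_gt0//; lra.
Qed.

Lemma ln_nat_ge1 n : (3 <= n)%N -> 1 <= ln n%:R :> R.
Proof.
move=> n3; apply: (le_trans ln3_ge1).
by rewrite ler_ln ?posrE ?ltr0n ?ler_nat// (leq_trans _ n3).
Qed.

Lemma norm_ln_ge1 (r : R) : 0 < r < 3^-1 -> `|ln r| = - ln r /\ 1 <= `|ln r|.
Proof.
move=> /andP[r0 r3].
have h : 1 <= - ln r.
  rewrite -lnV ?posrE//; apply: (le_trans ln3_ge1).
  by rewrite ler_ln ?posrE ?invr_gt0// -[leLHS]invrK lef_pV2 ?posrE ?invr_gt0// ltW.
by rewrite ler0_norm//; lra.
Qed.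

Lemma enorm2_gt0 (z : R * R) : z.2 != 0 -> 0 < enorm2 z.
Proof. by move=> z2; rewrite sqrtr_gt0 ltr_wpDl ?sqr_ge0// exprn_even_gt0. Qed.

Lemma omega_alpha_ge0 (z : R * R) : 0 <= omega_alpha alpha z.
Proof.
rewrite /omega_alpha; case: ifP => // _.
by rewrite invr_ge0 mulr_ge0 ?enorm2_ge0 ?powR_ge0.
Qed.

Lemma omega_n_ge0 n (z : R * R) : 0 <= omega_n alpha n z.
Proof.
rewrite /omega_n; case: ifP => // _; case: ifP => _; first exact: omega_alpha_ge0.
by rewrite divr_ge0 ?powR_ge0.
Qed.

Lemma omega_alpha_le (z : R * R) : omega_alpha alpha z <= (enorm2 z)^-1.
Proof.
rewrite /omega_alpha; case: ifPn => [/asboolP[z3 z2]|_]; last by rewrite invr_ge0 enorm2_ge0.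
have r0 : 0 < enorm2 z by rewrite enorm2_gt0// gt_eqF.
have [_ l1] := norm_ln_ge1 (enorm2 z) (introT andP (conj r0 z3)).
rewrite invfM ler_piMr ?invr_ge0 ?(ltW r0)// invf_le1 ?powR_gt0 ?(lt_le_trans ltr01)//.
exact: powR_ge1.
Qed.

(* On [r <= 1/n], [r |ln r|^alpha] is largest at [r = 1/n]: with [t = 1/(r n)],
   [|ln r| = ln n + ln t <= t ln n] because [ln t <= t - 1] and [ln n >= 1]. *)
Lemma omega_n_le_alpha n (z : R * R) : (4 <= n)%N -> z.2 != 0 ->
  omega_n alpha n z <= omega_alpha alpha z.
Proof.
move=> n4 z20; have r0 := enorm2_gt0 _ z20.
have nr0 : 0 < n%:R :> R by rewrite ltr0n (leq_trans _ n4).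
rewrite /omega_n; case: ifPn => [_|]; first exact: omega_alpha_ge0.
rewrite -leNgt le_eqVlt eq_sym (negbTE z20)/= => z2.
case: ifPn => // ; rewrite -leNgt => zn.
set r := enorm2 z in r0 zn *.
have n3 : n%:R^-1 < 3^-1 :> R by rewrite ltf_pV2 ?posrE// ltr_nat.
have r3 : r < 3^-1 by exact: le_lt_trans zn n3.
rewrite /omega_alpha asboolT//.
have [lE l1] : `|ln r| = - ln r /\ 1 <= `|ln r| by apply: norm_ln_ge1; rewrite r0.
have ln1 : 1 <= ln n%:R :> R by apply: ln_nat_ge1; rewrite ltnW.
have ln0 : 0 < ln n%:R :> R := lt_le_trans ltr01 ln1.
have l0 : 0 < `|ln r| := lt_le_trans ltr01 l1.
rewrite (ger0_norm (ltW ln0)) -/r -[n%:R / _]invrK invf_div lef_pV2 ?posrE ?mulr_gt0 ?invr_gt0 ?powR_gt0//.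
pose t := (r * n%:R)^-1.
have t1 : 1 <= t by rewrite -invr1 lef_pV2 ?posrE ?mulr_gt0// -ler_pdivlMr// mul1r.
have Lt : `|ln r| <= ln n%:R * t.
  have -> : `|ln r| = ln n%:R + ln t.
    by rewrite /t lnV ?posrE ?mulr_gt0// lnM ?posrE// lE; ring.
  have : ln t <= t - 1 by rewrite -[in leLHS](subrK 1 t) addrC le_ln1Dx//; lra.
  by nra.
have : `|ln r| `^ alpha <= ln n%:R `^ alpha * t.
  apply: (@le_trans _ _ ((ln n%:R * t) `^ alpha)).
    by rewrite ge0_ler_powR ?nnegrE ?normr_ge0// mulr_ge0 ?(ltW ln0)// (le_trans ler01).
  rewrite powRM ?(ltW ln0) ?(le_trans ler01)// ler_pM2l ?powR_gt0//.
  exact: ler1_powR.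
rewrite -(ler_pM2l r0) => /le_trans; apply.
by rewrite /t mulrCA invfM mulVKf ?gt_eqF.
Qed.

Lemma omega_n_le_inv n (z : R * R) : (4 <= n)%N -> z.2 != 0 ->
  omega_n alpha n z <= (enorm2 z)^-1.
Proof. by move=> n4 z2; apply: le_trans (omega_alpha_le z); exact: omega_n_le_alpha. Qed.

Lemma omega_n_bounded n : (2 <= n)%N -> exists2 M : R, 0 <= M &
  forall z, omega_n alpha n z <= M * \1_(`[-1, 1] `*` `[-1, 1]) z.
Proof.
(* The first summand bounds [1/|z|] outside the disc of radius [1/n], the second is the value inside
   it. *)
move=> n2; exists (n%:R + n%:R / (`|ln n%:R| `^ alpha)).
  by rewrite addr_ge0 ?divr_ge0 ?powR_ge0.
set M := _ + _ => z.
have M0 : 0 <= M by rewrite addr_ge0 ?divr_ge0 ?powR_ge0.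
have sq : enorm2 z <= 1 -> \1_(`[-1, 1] `*` `[-1, 1]) z = 1 :> R.
  move=> z1; have [h1 h2] := abs_le_enorm2 z.
  by rewrite indicE mem_set//; split; rewrite /= in_itv/= -ler_norml (le_trans _ z1).
have nr0 : 0 < n%:R :> R by rewrite ltr0n (leq_trans _ n2).
have b0 : 0 <= M * \1_(`[-1, 1] `*` `[-1, 1]) z by rewrite mulr_ge0// indicE.
rewrite /omega_n; case: ifPn => // _; case: ifPn => [nz|].
  have := omega_alpha_le z; rewrite /omega_alpha; case: ifPn => // /asboolP[z3 _] h.
  rewrite sq ?mulr1; last by rewrite ltW// (lt_trans z3)// invf_lt1// ltr1n.
  apply: (le_trans h); rewrite -[leLHS]addr0 lerD ?divr_ge0 ?powR_ge0//.
  by rewrite invf_ple ?posrE// ?(ltW nz)// (lt_trans _ nz)// invr_gt0.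
rewrite -leNgt => zn; rewrite sq ?mulr1 ?lerDr//.
by rewrite (le_trans zn)// invf_le1// ler1n ltnW.
Qed.

Lemma A2k_ge0 (kappa s : R) : 0 <= A2k kappa s.
Proof. exact: sqr_ge0. Qed.

Lemma A2k0 (kappa : R) : A2k kappa 0 = 0.
Proof. by rewrite /A2k mul0r expr0n. Qed.

Lemma le_A2k (kappa s t : R) : 0 <= kappa -> 0 <= s <= t -> A2k kappa s <= A2k kappa t.
Proof.
move=> k0 /andP[s0 st]; have t0 := le_trans s0 st.
have l s' : 0 <= s' -> 0 <= ln (2 + s') by move=> ?; rewrite ln_ge0//; lra.
rewrite /A2k ler_pXn2r// ?nnegrE ?mulr_ge0 ?powR_ge0//.
apply: ler_pM; rewrite ?powR_ge0// ge0_ler_powR ?nnegrE ?l//.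
by rewrite ler_ln ?posrE ?lerD2l//; lra.
Qed.

(** With [L = |ln r|], the logarithm in the Young function is at most a constant times [L], so the
    whole is at most a constant times [(r^-1 L^(kappa - alpha))^2]. The division by [e] prepares for
    the Luxemburg norm. *)
Lemma A2k_omega_alpha_le (kappa e : R) : 0 <= kappa -> 0 < e <= 1 ->
  exists2 C : R, 0 <= C & forall z,
    A2k kappa (omega_alpha alpha z / e) <= C * radial_bound (2 * (alpha - kappa)) z.
Proof.
move=> k0 /andP[e0 e1].
(* From [2 + w / e <= r^-2 / e] the logarithm is at most [2 L - ln e], hence at most [c L] because
   [L >= 1] and [ln e <= 0]. *)
pose c := 2 - ln e.
have c0 : 0 <= c by have := ln_le0 e1; rewrite /c; lra.
exists ((c `^ kappa / e) ^+ 2) => [|z]; first exact: sqr_ge0.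
have := omega_alpha_le z; have := omega_alpha_ge0 z.
rewrite /omega_alpha; case: ifPn => [/asboolP[z3 z2]|_ _ _]; last first.
  by rewrite mul0r A2k0 mulr_ge0 ?sqr_ge0 ?radial_bound_ge0.
have r0 : 0 < enorm2 z by rewrite enorm2_gt0// gt_eqF.
have r2 : enorm2 z < 2^-1 by rewrite (lt_trans z3)// ltf_pV2 ?posrE// ltr_nat.
have [lE l1] := norm_ln_ge1 (enorm2 z) (introT andP (conj r0 z3)).
rewrite /radial_bound r0 r2/=; set r := enorm2 z in z3 r0 r2 lE l1 *.
set L := `|ln r| in lE l1 *.
have L0 : 0 < L := lt_le_trans ltr01 l1.
set w := (_)^-1 => w0 wr.
have lnw : ln (2 + w / e) <= c * L.
  have r1 : 3 <= r^-1 by rewrite -[3]invrK lef_pV2 ?posrE ?invr_gt0// ltW.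
  have e1' : 1 <= e^-1 by rewrite -invr1 lef_pV2 ?posrE.
  have we : w / e <= r^-1 / e by rewrite ler_pM2r ?invr_gt0.
  have we0 : 0 <= w / e by rewrite divr_ge0// ltW.
  have h : 2 + w / e <= r^-1 ^+ 2 / e.
    apply: (@le_trans _ _ ((2 + r^-1) / e)); first by nra.
    by rewrite ler_pM2r ?invr_gt0//; nra.
  apply: (@le_trans _ _ (ln (r^-1 ^+ 2 / e))).
    by rewrite ler_ln ?posrE//; [lra|rewrite divr_gt0 ?exprn_gt0 ?invr_gt0].
  rewrite lnM ?posrE ?exprn_gt0 ?invr_gt0// lnXn ?invr_gt0// !lnV ?posrE// -lE /c.
  by have := ln_le0 e1; rewrite -mulr_natl; nra.
have we0 : 0 <= w / e by rewrite divr_ge0// ltW.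
have -> : (r ^+ 2 * L `^ (2 * (alpha - kappa)))^-1 = (w * L `^ kappa) ^+ 2.
  rewrite [2 * _]mulrC powRrM powR_mulrn ?powR_ge0// -exprMn -exprVn; congr (_ ^+ 2).
  rewrite powRD; last by rewrite (gt_eqF L0) implybT.
  rewrite powRN /w; field.
  by rewrite !gt_eqF ?powR_gt0.
rewrite /A2k -exprMn ler_pXn2r ?nnegrE ?mulr_ge0 ?powR_ge0 ?invr_ge0 ?(ltW e0) ?mulr_ge0 ?(ltW r0) ?powR_ge0//.
have -> : c `^ kappa / e * (w * L `^ kappa) = w / e * (c * L) `^ kappa.
  by rewrite powRM ?(ltW L0)//; ring.
rewrite ler_wpM2l// ge0_ler_powR ?nnegrE ?mulr_ge0 ?(ltW L0)//.
by rewrite ln_ge0//; lra.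
Qed.
End omega_bounds.

(** * Strong convergence in the Luxemburg norm *)

Section strong_convergence.
Context {R : realType}.
Variables alpha kappa : R.
Hypotheses (alpha_le1 : alpha <= 1) (kappa_ge0 : 0 <= kappa) (kappa_lt : kappa < alpha - 2^-1).

Let alpha_ge0 : 0 <= alpha. Proof. move: kappa_ge0 kappa_lt; lra. Qed.
(** The condition [kappa < alpha - 1/2] is exactly the integrability condition for the radial
    majorant. *)
Let b_gt1 : 1 < 2 * (alpha - kappa). Proof. move: kappa_ge0 kappa_lt; lra. Qed.

Lemma in_L2logL_omega_alpha : in_L2logL kappa (omega_alpha alpha).
Proof.
have [C C0 hC] : exists2 C : R, 0 <= C & forall z,
    A2k kappa (omega_alpha alpha z / 1) <= C * radial_bound (2 * (alpha - kappa)) z.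
  by apply: A2k_omega_alpha_le => //; rewrite ltr01 lexx.
apply: (@le_lt_trans _ _ (\int[@leb2 R]_z (C%:E * (radial_bound (2 * (alpha - kappa)) z)%:E))%E).
  apply: le_integralT => z; rewrite -EFinM lee_fin ger0_norm ?omega_alpha_ge0//.
  by have := hC z; rewrite divr1.
rewrite ge0_integralZl_EFin//.
- by rewrite lte_mul_pinfty ?lee_fin// integral_radial_bound_lty.
- by move=> z _; rewrite lee_fin radial_bound_ge0.
- by apply/measurable_EFinP; exact: measurable_radial_bound.
Qed.

Lemma in_L2logL_omega_n n : (2 <= n)%N -> in_L2logL kappa (omega_n alpha n).
Proof.
move=> n2; have [M M0 hM] := @omega_n_bounded _ alpha alpha_ge0 n n2.
set Q := (_ `*` _) in hM.
have mQ : measurable Q by apply: measurableX.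
apply: (@le_lt_trans _ _ (\int[@leb2 R]_z (A2k kappa M * \1_Q z)%:E)%E).
  apply: le_integralT => z; rewrite lee_fin ger0_norm ?omega_n_ge0//.
  have := hM z; have := @omega_n_ge0 _ alpha n z; rewrite indicE; case: (z \in Q) => /= h0.
    by rewrite !mulr1 => h; apply: le_A2k => //; rewrite h0.
  rewrite !mulr0 => h; have -> : omega_n alpha n z = 0 by apply/eqP; rewrite eq_le h0 h.
  by rewrite A2k0.
rewrite leb2_integral_indic ?A2k_ge0// leb2_rect// lebesgue_measure_itv/=.
by rewrite ifT ?lte_fin ?gtrN// -EFinB -!EFinM ltry.
Qed.

Lemma near_integral_A2k_le1 (e : R) : 0 < e <= 1 ->
  \forall n \near \oo,
    (\int[@leb2 R]_z (A2k kappa (`|omega_n alpha n z - omega_alpha alpha z| / e))%:E <= 1)%E.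
Proof.
move=> e01; have /andP[e0 e1] := e01.
have [C C0 hC] := @A2k_omega_alpha_le _ alpha alpha_ge0 kappa e kappa_ge0 e01.
pose b := 2 * (alpha - kappa).
pose g z := (C * radial_bound b z)%:E.
have mg : measurable_fun setT g.
  by apply/measurable_EFinP; apply: measurable_funM => //; exact: measurable_radial_bound.
have g0 z : (0 <= g z)%E by rewrite lee_fin mulr_ge0 ?radial_bound_ge0.
have ig : (@leb2 R).-integrable setT g.
  apply/integrableP; split => //.
  under eq_integral do rewrite gee0_abs ?g0//.
  rewrite /g; under eq_integral do rewrite EFinM.
  rewrite ge0_integralZl_EFin//.
  - by rewrite lte_mul_pinfty ?lee_fin// integral_radial_bound_lty.
  - by move=> z _; rewrite lee_fin radial_bound_ge0.
  - by apply/measurable_EFinP; exact: measurable_radial_bound.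
(* Outside the disc of radius [1/n] the difference vanishes off the axis, so [g] cut to that disc
   still dominates. These cuts tend to zero at every point, the origin included, since
   [radial_bound] is zero there. *)
pose f n z : \bar R := if enorm2 z <= n%:R^-1 then g z else 0%E.
have f0 n z : (0 <= f n z)%E by rewrite /f; case: ifP.
have mf n : measurable_fun setT (f n).
  apply: measurable_fun_ifT => //.
  by apply: measurable_fun_ler => //; exact: measurable_enorm2.
have f_cvg z : f n z @[n --> \oo] --> 0%E.
  apply: cvg_near_cst.
  have [z0|z0] := leP (enorm2 z) 0.
    apply: nearW => n; rewrite /f; case: ifP => // _.
    by rewrite /g /radial_bound ltNge z0/= mulr0.
  near=> n; rewrite /f ifF//; apply/negbTE; rewrite -ltNge.
  rewrite invf_plt ?posrE//; last by rewrite ltr0n; near: n; exists 1%N.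
  by near: n; exact: nbhs_infty_gtr.
have ae1 : {ae @leb2 R, forall z, setT z -> f ^~ z @ \oo --> cst 0%E z}.
  by apply: aeW => z _; exact: f_cvg.
have ae2 : {ae @leb2 R, forall z n, setT z -> (`|f n z| <= g z)%E}.
  by apply: aeW => z n _; rewrite gee0_abs// /f; case: ifP.
have [_ _ h] := dominated_convergence measurableT mf (measurable_cst _) ae1 ig ae2.
rewrite integral0 in h.
have h1 : \forall n \near \oo, (\int[@leb2 R]_z f n z <= 1)%E.
  have /fine_cvgP[hfin /cvgrPdist_le/(_ 1 ltr01) hcvg] := h.
  near=> n.
  have fin : (\int[@leb2 R]_z f n z)%E \is a fin_num by near: n; exact: hfin.
  rewrite -(fineK fin) lee_fin; apply: le_trans (ler_norm _) _.
  by rewrite -normrN -sub0r; near: n; exact: hcvg.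
near=> n.
apply: (@le_trans _ _ (\int[@leb2 R]_z f n z)%E); last first.
  by near: n; exact: h1.
have n4 : (4 <= n)%N by near: n; exists 4%N.
apply: leb2_le_integral_off_axis => // z z2.
rewrite /f; case: ifPn => [zn|].
  apply: (@le_trans _ _ (A2k kappa (omega_alpha alpha z / e))%:E); last by rewrite lee_fin hC.
  rewrite lee_fin; apply: le_A2k => //; rewrite divr_ge0 ?(ltW e0)//= ler_pM2r ?invr_gt0//.
  have := @omega_n_le_alpha _ alpha alpha_ge0 alpha_le1 n z n4 z2; have := @omega_n_ge0 _ alpha n z.
  by move=> wn0 wna; rewrite ler0_norm; lra.
rewrite -ltNge => nz; rewrite /omega_n nz.
case: ifPn => z0; last by rewrite subrr normr0 mul0r A2k0.
rewrite /omega_alpha asboolF ?subrr ?normr0 ?mul0r ?A2k0//.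
by move=> [_]; rewrite ltNge (ltW z0).
Unshelve. all: by end_near. Qed.

Lemma lux_norm_ge0 (f : R * R -> R) : (0 <= lux_norm kappa f)%E.
Proof.
by apply/ereal_infP => _ [k [k0 _] <-]; rewrite lee_fin ltW.
Qed.

Lemma lux_norm_cvg0 :
  (fun n : nat => lux_norm kappa (omega_n alpha n \- omega_alpha alpha)) @ \oo --> 0%E.
Proof.
have h (e : R) : 0 < e -> \forall n \near \oo,
    (lux_norm kappa (omega_n alpha n \- omega_alpha alpha)%R <= e%:E)%E.
  (* The modular bound is available for levels at most 1, hence the minimum. *)
  move=> e0; have e'01 : 0 < Num.min e 1 <= 1 by rewrite lt_min e0 ltr01/= ge_min lexx orbT.
  have /andP[e'0 _] := e'01.
  near=> n; apply: ge_ereal_inf; exists (Num.min e 1)%:E; last by rewrite lee_fin ge_min lexx.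
  exists (Num.min e 1) => //; split => //.
  by near: n; exact: near_integral_A2k_le1.
apply/fine_cvgP; split.
  near=> n; apply/fin_numPlt; rewrite (lt_le_trans _ (lux_norm_ge0 _))//=.
  by apply: (@le_lt_trans _ _ 1%:E); [near: n; exact: h|exact: ltry].
apply/cvgrPdist_le => e e0; near=> n.
have hn : (lux_norm kappa (omega_n alpha n \- omega_alpha alpha)%R <= e%:E)%E by near: n; exact: h.
rewrite sub0r normrN ger0_norm ?fine_ge0 ?lux_norm_ge0//= -lee_fin fineK//.
apply/fin_numPlt; rewrite (lt_le_trans _ (lux_norm_ge0 _))//=.
exact: le_lt_trans hn (ltry _).
Unshelve. all: by end_near. Qed.

End strong_convergence.

(** * Lower bound on the first velocity component *)

Section velocity.
Context {R : realType}.
Local Notation mu := (@lebesgue_measure R).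

Lemma K1E (x y : R * R) : K1 (x.1 - y.1, x.2 - y.2) =
  (y.2 - x.2) / (2 * pi * ((x.1 - y.1) ^+ 2 + (x.2 - y.2) ^+ 2)).
Proof. by rewrite /K1 sqr_enorm2/= opprB. Qed.

Lemma le_abs_K1 (x y : R * R) : `|K1 (x.1 - y.1, x.2 - y.2)| <=
  (2 * pi)^-1 * (`|x.2 - y.2| / ((x.1 - y.1) ^+ 2 + `|x.2 - y.2| ^+ 2)).
Proof.
rewrite K1E normrM normfV distrC real_normK ?num_real// (ger0_norm (x := 2 * pi * _)).
  by rewrite invfM mulrCA.
by rewrite !mulr_ge0 ?pi_ge0// addr_ge0 ?sqr_ge0.
Qed.

Lemma am_gm_weighted (e p v : R) : 0 < e ->
  2 * (p * v) <= e * p ^+ 2 + e^-1 * v ^+ 2.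
Proof.
move=> e0; rewrite -subr_ge0.
have -> : e * p ^+ 2 + e^-1 * v ^+ 2 - 2 * (p * v) = e^-1 * (e * p - v) ^+ 2.
  by field; rewrite gt_eqF.
by rewrite mulr_ge0 ?sqr_ge0// invr_ge0 ltW.
Qed.

Variables (alpha : R) (n : nat).
Hypotheses (alpha_ge0 : 0 <= alpha) (alpha_le1 : alpha <= 1) (n_ge4 : (4 <= n)%N).
Local Notation w := (omega_n alpha n).
Local Notation f := (fun x y : R * R => K1 (x.1 - y.1, x.2 - y.2) * w y).

Lemma measurable_biot_savart (x : R * R) : measurable_fun setT (f x).
Proof. by apply: measurable_funM; [exact: measurable_K1|exact: measurable_omega_n]. Qed.

(** For fixed [n] the vorticity is bounded with bounded support. Relaxing its support to the strip
    [|y.2| <= 1], the Poisson integral in [y.1] cancels the factor [|x.2 - y.2|] and leaves the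
    constant [M / 2] on [[-1, 1]]. Integrability makes [u1] the true difference of the integrals of
    the two parts. *)
Lemma integrable_biot_savart (x : R * R) : (@leb2 R).-integrable setT (EFin \o f x).
Proof.
apply/integrableP; split; first by apply/measurable_EFinP; exact: measurable_biot_savart.
have [M M0 hM] := @omega_n_bounded _ alpha alpha_ge0 n (leq_trans (isT : (2 <= 4)%N) n_ge4).
pose P (y : R * R) := ((x.1 - y.1) ^+ 2 + `|x.2 - y.2| ^+ 2)^-1.
pose c (t : R) := M * (2 * pi)^-1 * \1_(`[-1, 1]%classic) t * `|x.2 - t|.
have c0 t : 0 <= c t.
  by rewrite !mulr_ge0 ?invr_ge0 ?mulr_ge0 ?pi_ge0// indicE.
have P0 y : 0 <= P y by rewrite invr_ge0 addr_ge0 ?sqr_ge0.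
have mP : measurable_fun setT P.
  apply: measurable_funV; apply: measurable_funD; apply: measurable_funX.
    by apply: measurable_funB.
  by apply: measurable_fun_norm; apply: measurable_funB.
have m1 : measurable_fun setT (fun y : R * R => \1_(`[-1, 1]%classic) y.2 : R).
  by apply: (@measurableT_comp _ _ _ _ _ _ (\1_(`[-1, 1]%classic) : R -> R)).
have mc : measurable_fun setT (fun y : R * R => c y.2).
  apply: measurable_funM; first by apply: measurable_funM.
  by apply: measurable_fun_norm; apply: measurable_funB.
apply: (@le_lt_trans _ _ (\int[@leb2 R]_y (c y.2 * P y)%:E)%E).
  apply: le_integralT => y; rewrite abse_EFin lee_fin normrM (ger0_norm (omega_n_ge0 _ _ _)).
  apply: (@le_trans _ _ ((2 * pi)^-1 * (`|x.2 - y.2| * P y) * (M * \1_(`[-1, 1]%classic) y.2))).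
    apply: ler_pM => //; first exact: omega_n_ge0.
      exact: le_abs_K1.
    apply: (le_trans (hM y)); rewrite ler_wpM2l//.
    rewrite !indicE ler_nat; case: (boolP (y \in _)) => //.
    by rewrite inE => -[_ y2]; rewrite (mem_set y2).
  by rewrite /c le_eqVlt; apply/orP; left; apply/eqP; ring.
rewrite leb2_integral_iter; first last.
- by move=> y; rewrite lee_fin mulr_ge0.
- by apply/measurable_EFinP; exact: measurable_funM.
apply: (@le_lt_trans _ _ (\int[mu]_t (M / 2 * \1_(`[-1, 1]%classic) t)%:E)%E).
  apply: le_integralT => t /=.
  (* At this height the Poisson integral would have width zero, but the factor [|x.2 - t|] kills the
     integrand. *)
  have [->|xt] := eqVneq t x.2.
    under eq_integral do rewrite /c subrr normr0 mulr0 mul0r.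
    by rewrite integral0 lee_fin mulr_ge0// ?divr_ge0// indicE.
  have xt0 : 0 < `|x.2 - t| by rewrite normr_gt0 subr_eq0 eq_sym.
  under eq_integral do rewrite EFinM.
  rewrite ge0_integralZl_EFin//; first last.
  - by apply/measurable_EFinP; exact: (measurable_fun_pair1 t mP).
  - by move=> s _; rewrite lee_fin P0.
  apply: (le_trans (lee_wpmul2l _ (integral_poisson_le x.1 _ xt0))); first by rewrite lee_fin.
  rewrite -EFinM lee_fin /c le_eqVlt; apply/orP; left; apply/eqP.
  move: (pi_gt0 R); generalize (@pi R) => p p0.
  by field; rewrite !gt_eqF.
under eq_integral do rewrite EFinM.
rewrite ge0_integralZl_EFin ?divr_ge0//; last by apply/measurable_EFinP; exact: measurable_indic.
rewrite integral_indic// setIT /= lebesgue_measure_itv/=.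
by case: ifP => _; rewrite ?mule0 ?ltry// -EFinB -EFinM ltry.
Qed.

Lemma integral_biot_savart_neg_le (x : R * R) : 0 <= x.2 ->
  (\int[@leb2 R]_y ((EFin \o f x)^\- y) <= (pi / 2)%:E)%E.
Proof.
move=> x0.
(* The weight that balances the two terms: after integration in [y.1], [e * pi / (x.2 - t)] and
   [e^-1 * pi / t] are both [pi / sqrt (t (x.2 - t))]. *)
pose e (t : R) := Num.sqrt (x.2 - t) / Num.sqrt t.
pose P (y : R * R) := ((x.1 - y.1) ^+ 2 + (x.2 - y.2) ^+ 2)^-1.
pose V (y : R * R) := ((0 - y.1) ^+ 2 + y.2 ^+ 2)^-1.
pose I : set R := `]0, x.2[%classic.
pose g (y : R * R) := \1_I y.2 * (4 * pi)^-1 * (e y.2 * P y + (e y.2)^-1 * V y).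
have pi0 := pi_gt0 R.
have e0 t : 0 <= e t by rewrite divr_ge0 ?sqrtr_ge0.
have P0 y : 0 <= P y by rewrite invr_ge0 addr_ge0 ?sqr_ge0.
have V0 y : 0 <= V y by rewrite invr_ge0 addr_ge0 ?sqr_ge0.
have g0 y : 0 <= g y.
  apply: mulr_ge0; last by apply: addr_ge0; apply: mulr_ge0; rewrite ?P0 ?V0 ?invr_ge0 ?e0.
  by rewrite mulr_ge0 ?indicE// invr_ge0 mulr_ge0// ltW.
have m1 : measurable_fun setT (fun y : R * R => \1_I y.2 : R).
  by apply: (@measurableT_comp _ _ _ _ _ _ (\1_I : R -> R)) => //;
    apply: measurable_indic; exact: measurable_itv.
have mP : measurable_fun setT P.
  by apply: measurable_funV; apply: measurable_funD; apply: measurable_funX; apply: measurable_funB.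
have mV : measurable_fun setT V.
  apply: measurable_funV; apply: measurable_funD; apply: measurable_funX => //.
  by apply: measurable_funB.
have me : measurable_fun setT (fun y : R * R => e y.2).
  apply: measurable_funM; first by apply: measurable_fun_sqrt; apply: measurable_funB.
  by apply: measurable_funV; apply: measurable_fun_sqrt.
have mg : measurable_fun setT g.
  apply: measurable_funM; first exact: measurable_funM.
  by apply: measurable_funD; apply: measurable_funM => //; exact: measurable_funV.
apply: (@le_trans _ _ (\int[@leb2 R]_y (g y)%:E)%E).
  apply: leb2_le_integral_off_axis => //.
  - exact/measurable_EFinP.
  - move=> y y2; rewrite funenegE/= ge_max [X in _ && X]lee_fin g0 andbT lee_fin.
    have [y0|y0] := ltP y.2 0.
      by rewrite /omega_n y0 mulr0 oppr0.
    have {}y0 : 0 < y.2 by rewrite lt_def y2.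
    (* At or above the height of [x] the kernel is nonnegative and the negative part vanishes. *)
    have [yx|yx] := ltP y.2 x.2; last first.
      apply: (@le_trans _ _ 0) => //; rewrite oppr_le0 mulr_ge0 ?omega_n_ge0// K1E.
      by rewrite divr_ge0 ?subr_ge0// !mulr_ge0 ?(ltW pi0)// addr_ge0 ?sqr_ge0.
    have yI : \1_I y.2 = 1 :> R by rewrite indicE mem_set// /I/= in_itv/= y0.
    have h0 : 0 < x.2 - y.2 by rewrite subr_gt0.
    have et0 : 0 < e y.2 by rewrite divr_gt0 ?sqrtr_gt0.
    have nE : ((enorm2 y)^-1) ^+ 2 = V y by rewrite exprVn sqr_enorm2 /V sub0r sqrrN.
    have wle := @omega_n_le_inv _ alpha alpha_ge0 alpha_le1 n y n_ge4 y2.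
    have p1 : - (K1 (x.1 - y.1, x.2 - y.2) * w y) <=
        (2 * pi)^-1 * ((x.2 - y.2) * P y * (enorm2 y)^-1).
      have -> : - (K1 (x.1 - y.1, x.2 - y.2) * w y) = (2 * pi)^-1 * ((x.2 - y.2) * P y * w y).
        by rewrite K1E -mulNr -mulNr opprB invfM -/(P y) -!mulrA mulrCA.
      rewrite ler_pM2l ?invr_gt0 ?mulr_gt0//.
      by rewrite ler_wpM2l// mulr_ge0// ltW.
    apply: (le_trans p1); rewrite /g yI mul1r.
    (* The square of the vertical gap is at most the squared distance, so the squared kernel is
       again of Poisson type. *)
    have PP : ((x.2 - y.2) * P y) ^+ 2 <= P y.
      have D0 : 0 < (x.1 - y.1) ^+ 2 + (x.2 - y.2) ^+ 2 by rewrite ltr_wpDl ?sqr_ge0// exprn_gt0.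
      rewrite exprMn [P y ^+ 2]expr2 mulrA ler_piMl// ler_pdivrMr// mul1r lerDr sqr_ge0//.
    have := am_gm_weighted (e y.2) ((x.2 - y.2) * P y) (enorm2 y)^-1 et0.
    rewrite nE => amgm.
    have -> : (4 * pi)^-1 = (2 * pi)^-1 * 2^-1 :> R by rewrite -invfM; congr _^-1; ring.
    rewrite -[leRHS]mulrA ler_pM2l ?invr_gt0 ?mulr_gt0// ler_pdivlMl//.
    by apply: (le_trans amgm); rewrite lerD2r ler_pM2l.
rewrite leb2_integral_iter; first last.
- by move=> y; rewrite lee_fin.
- exact/measurable_EFinP.
(* The two equal terms sum to [2 pi], which the prefactor [1 / (4 pi)] turns into 1/2. *)
apply: (@le_trans _ _ (\int[mu]_t (2^-1%:E * (((fun t => ((Num.sqrt (t * (x.2 - t)))^-1)%:E) \_ I) t)))%E).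
  apply: le_integralT => t.
  rewrite patchE; case: ifPn => [|tI]; last first.
    under eq_integral do rewrite /g indicE/= (negbTE tI) !mul0r.
    by rewrite integral0 mule0.
  rewrite inE /I/= in_itv/= => /andP[t0 tx].
  have h0 : 0 < x.2 - t by rewrite subr_gt0.
  have et0 : 0 < e t by rewrite divr_gt0 ?sqrtr_gt0.
  have tI : \1_I t = 1 :> R by rewrite indicE mem_set// /I/= in_itv/= t0.
  rewrite /g /= tI mul1r.
  under eq_integral do rewrite EFinM EFinD.
  have mPt : measurable_fun setT (fun s => (e t * P (s, t))%:E).
    by apply/measurable_EFinP; apply: measurable_funM => //; exact: (measurable_fun_pair1 t mP).
  have mVt : measurable_fun setT (fun s => ((e t)^-1 * V (s, t))%:E).
    by apply/measurable_EFinP; apply: measurable_funM => //; exact: (measurable_fun_pair1 t mV).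
  rewrite ge0_integralZl_EFin ?invr_ge0 ?mulr_ge0 ?(ltW pi0)//; first last.
  - exact: emeasurable_funD.
  - by move=> s _; rewrite -EFinD lee_fin; apply: addr_ge0; apply: mulr_ge0; rewrite ?P0 ?V0 ?invr_ge0 ?e0.
  rewrite ge0_integralD//; first last.
  - by move=> s _; rewrite lee_fin mulr_ge0 ?V0 ?invr_ge0 ?e0.
  - by move=> s _; rewrite lee_fin mulr_ge0.
  under eq_integral do rewrite EFinM.
  under [X in (_ + X)%E]eq_integral do rewrite EFinM.
  rewrite !ge0_integralZl_EFin ?invr_ge0//; first last.
  - by apply/measurable_EFinP; exact: (measurable_fun_pair1 t mP).
  - by move=> s _; rewrite lee_fin.
  - by apply/measurable_EFinP; exact: (measurable_fun_pair1 t mV).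
  - by move=> s _; rewrite lee_fin.
  apply: (@le_trans _ _ (((4 * pi)^-1)%:E * ((e t)%:E * (pi / (x.2 - t))%:E + ((e t)^-1)%:E * (pi / t)%:E))%E).
    apply: lee_wpmul2l; first by rewrite lee_fin invr_ge0 mulr_ge0// ltW.
    apply: leeD; apply: lee_wpmul2l; rewrite ?lee_fin ?invr_ge0//.
      exact: (integral_poisson_le x.1 (x.2 - t) h0).
    exact: (integral_poisson_le 0 t t0).
  rewrite -[X in (X + _)%E]EFinM -[X in (_ + X)%E]EFinM -EFinD -[leLHS]EFinM -[leRHS]EFinM lee_fin.
  rewrite /e sqrtrM ?(ltW t0)//.
  have hE := sqr_sqrtr (ltW h0); have tE := sqr_sqrtr (ltW t0).
  have sh0 : 0 < Num.sqrt (x.2 - t) by rewrite sqrtr_gt0.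
  have st0 : 0 < Num.sqrt t by rewrite sqrtr_gt0.
  rewrite le_eqVlt; apply/orP; left; apply/eqP.
  move: hE tE sh0 st0; set a := Num.sqrt (x.2 - t); set b := Num.sqrt t => hE tE a0 b0.
  rewrite -hE -tE; clearbody a b.
  move: pi0; generalize (@pi R) => p p0.
  by field; rewrite !gt_eqF.
have mS : measurable_fun setT (fun t : R => (Num.sqrt (t * (x.2 - t)))^-1).
  apply: measurable_funV; apply: measurable_fun_sqrt; apply: measurable_funM => //.
  by apply: measurable_funB.
have mI : measurable I by exact: measurable_itv.
have mSI : measurable_fun I (fun t : R => ((Num.sqrt (t * (x.2 - t)))^-1)%:E).
  by apply: measurable_funTS; exact/measurable_EFinP.
have mSr : measurable_fun setT ((fun t : R => ((Num.sqrt (t * (x.2 - t)))^-1)%:E) \_ I).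
  by have := (measurable_restrictT _ mI).1 mSI; exact.
rewrite ge0_integralZl_EFin//; first last.
  by move=> t _; apply: erestrict_ge0 => s _; rewrite lee_fin invr_ge0 sqrtr_ge0.
rewrite -integral_mkcond.
have [x00|x00] := leP x.2 0.
  rewrite /I set_itv_ge ?integral_set0 ?mule0 ?lee_fin ?divr_ge0 ?(ltW pi0)//.
  by rewrite -leNgt bnd_simp.
apply: (le_trans (lee_wpmul2l _ (integral_arcsine_le _ x00))) => //.
by rewrite -EFinM lee_fin mulrC.
Qed.
End velocity.

(** * Lower bounds on dyadic boxes *)

Section boxes.
Context {R : realType}.

(** By disjointness at most one term of the sum is nonzero at each point. *)
Lemma sum_indic_le (T : Type) (B : nat -> set T) (c : nat -> R) (F : T -> R) (a b : nat) :
  (forall i j y, B i y -> B j y -> i = j) ->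
  (forall k y, (a <= k < b)%N -> B k y -> c k <= F y) -> (forall y, 0 <= F y) ->
  forall y, \sum_(a <= k < b) c k * \1_(B k) y <= F y.
Proof.
move=> disj cF F0 y.
have [[k [kab Bk]]|nB] := pselect (exists k, (a <= k < b)%N /\ B k y).
  rewrite (bigD1_seq k) ?mem_index_iota ?iota_uniq//= big1 => [|i ik].
    by rewrite addr0 indicE (mem_set Bk) mulr1; exact: cF.
  rewrite indicE memNset ?mulr0// => Bi.
  by move: ik; rewrite (disj _ _ _ Bi Bk) eqxx.
rewrite big_nat big1 => [|k kab]; first exact: F0.
by rewrite indicE memNset ?mulr0// => Bk; apply: nB; exists k.
Qed.

Lemma leb2_integral_sum_indic (B : nat -> set (R * R)) (c v : nat -> R) (a b : nat) :
  (forall k, measurable (B k)) -> (forall k, leb2 (B k) = (v k)%:E) -> (forall k, 0 <= c k) ->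
  (\int[@leb2 R]_z (\sum_(a <= k < b) c k * \1_(B k) z)%:E = (\sum_(a <= k < b) c k * v k)%:E)%E.
Proof.
move=> mB vB c0.
under eq_integral do rewrite -sumEFin.
rewrite ge0_integral_sum//.
- rewrite -sumEFin; apply: eq_bigr => k _.
  by rewrite leb2_integral_indic// vB -EFinM.
- move=> k; apply/measurable_EFinP; apply: measurable_funM => //.
- by move=> k z _; rewrite lee_fin mulr_ge0// indicE.
Qed.

Definition dyadic (k : nat) : R := 2^-1 ^+ k.

(** Both the distance to the origin and the side are comparable to [dyadic k], and boxes of smaller
    index lie strictly higher, which makes [K1] positive from a box to those below it. *)
Definition box (k : nat) : set (R * R) :=
  `]0, dyadic k / 2]%classic `*` `]dyadic k / 2, dyadic k]%classic.

Lemma dyadic_gt0 k : 0 < dyadic k. Proof. by rewrite exprn_gt0. Qed.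

Lemma le_dyadic k m : (k <= m)%N -> dyadic m <= dyadic k.
Proof. by move=> km; rewrite ler_wiXn2l//; lra. Qed.

Lemma dyadicS k : dyadic k.+1 = dyadic k / 2.
Proof. by rewrite /dyadic exprS mulrC. Qed.

Lemma boxP k (y : R * R) : box k y ->
  [/\ 0 < y.1, y.1 <= dyadic k / 2, dyadic k / 2 < y.2 & y.2 <= dyadic k].
Proof. by rewrite /box/= !in_itv/= => -[/andP[? ?] /andP[? ?]]. Qed.

Lemma measurable_box k : measurable (box k).
Proof. exact: measurableX. Qed.

Lemma leb2_box k : leb2 (box k) = (dyadic k ^+ 2 / 4)%:E.
Proof.
have q0 := dyadic_gt0 k.
rewrite leb2_rect// !lebesgue_measure_itv/= !lte_fin ifT ?divr_gt0//.
rewrite ifT; last by lra.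
by rewrite -!EFinB -EFinM; congr EFin; field.
Qed.

Lemma box_disj i j (y : R * R) : box i y -> box j y -> i = j.
Proof.
wlog ij : i j / (i < j)%N => [h|/boxP[_ _ h1 _] /boxP[_ _ _ h2]].
  by have [ij|ij|//] := ltngtP i j => Bi Bj; [exact: h|apply/esym; exact: h].
by exfalso; have := le_dyadic _ _ ij; rewrite dyadicS; lra.
Qed.

Lemma box_enorm2 k (y : R * R) : (2 <= k)%N -> box k y ->
  [/\ dyadic k / 2 < enorm2 y, enorm2 y <= 2 * dyadic k & enorm2 y < 3^-1].
Proof.
move=> k2 /boxP[h1 h2 h3 h4].
have q0 := dyadic_gt0 k.
have q4 : dyadic k <= 4^-1 by have := le_dyadic _ _ k2; rewrite /dyadic; lra.
have [_ h] := abs_le_enorm2 y.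
(* Indeed [1/4 + 1 <= (5/4)^2]; with [dyadic k <= 1/4] this gives 5/16, below 1/3. *)
have le1 : enorm2 y <= 5 / 4 * dyadic k.
  rewrite -[leRHS]ger0_norm; last by rewrite mulr_ge0 ?divr_ge0// ltW.
  rewrite -sqrtr_sqr ler_wsqrtr//; nra.
split; last 2 first.
- by lra.
- by lra.
by apply: lt_le_trans h; rewrite gtr0_norm; lra.
Qed.

Variables (alpha : R).
Hypotheses (alpha_ge0 : 0 <= alpha) (alpha_le23 : alpha <= 2 / 3).

(** The condition on [n] puts the box outside the disc of radius [1/n], where [omega_n] is
    [omega_alpha]; moreover [|ln r| <= (k+1) ln 2 <= k+1] there. *)
Lemma omega_n_box_ge n k (y : R * R) : (2 <= k)%N -> (2 ^ k.+1 <= n)%N -> box k y ->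
  (2 * dyadic k * k.+1%:R `^ alpha)^-1 <= omega_n alpha n y.
Proof.
move=> k2 kn By; have [r1 r2 r3] := box_enorm2 _ _ k2 By.
have [_ _ y2 _] := boxP _ _ By.
have q0 := dyadic_gt0 k.
have r0 : 0 < enorm2 y by lra.
have y20 : 0 < y.2 by lra.
rewrite /omega_n ifF; last by apply/negbTE; rewrite -leNgt ltW.
rewrite ifT; last first.
  apply: le_lt_trans r1; rewrite -dyadicS /dyadic exprVn lef_pV2 ?posrE ?exprn_gt0//.
    by rewrite -natrX ler_nat.
  by rewrite ltr0n (leq_trans _ kn)// expn_gt0.
rewrite /omega_alpha asboolT//.
have [lE l1] := norm_ln_ge1 (enorm2 y) (introT andP (conj r0 r3)).
rewrite lef_pV2 ?posrE ?mulr_gt0 ?powR_gt0// ?(lt_le_trans ltr01)//.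
apply: ler_pM; rewrite ?enorm2_ge0 ?powR_ge0//.
rewrite ge0_ler_powR ?nnegrE//.
have : ln (dyadic k.+1) <= ln (enorm2 y) by rewrite ler_ln ?posrE ?dyadic_gt0// dyadicS ltW.
rewrite lE /dyadic lnXn// lnV ?posrE//.
have h1 : ln 2 <= 1 :> R by rewrite (_ : 2 = 1 + 1)// le_ln1Dx//; lra.
rewrite mulNrn -[ln 2 *+ _]mulr_natl => h2.
have : k.+1%:R * ln 2 <= k.+1%:R :> R by rewrite ler_piMr.
by lra.
Qed.

(** Three scales of separation give a vertical gap of at least [3/8] of [dyadic k], while the
    squared distance is at most [5/4 dyadic k ^ 2]. With [pi <= 4] the denominator is at most
    [10 dyadic k ^ 2], and [32 * 3/8 = 12]. *)
Lemma K1_box_ge k m (x y : R * R) : (k.+3 <= m)%N -> box m x -> box k y ->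
  (32 * dyadic k)^-1 <= K1 (x.1 - y.1, x.2 - y.2).
Proof.
move=> km /boxP[x1 x2 x3 x4] /boxP[y1 y2 y3 y4].
have q0 := dyadic_gt0 k; have qm := dyadic_gt0 m.
have qkm : dyadic m <= dyadic k / 2 / 2 / 2 by rewrite -!dyadicS le_dyadic.
have pi0 := pi_gt0 R.
have pi4 : pi <= 4 :> R by have [/andP[_ h] _] := pihalf_02_cos_pihalf R; lra.
rewrite K1E; set D := (x.1 - y.1) ^+ 2 + _.
have D0 : 0 < D by rewrite /D ltr_wpDl ?sqr_ge0// exprn_even_gt0//= lt_eqF//; lra.
have Dq : D <= 5 / 4 * dyadic k ^+ 2.
  have : 0 <= (dyadic k / 2 - (x.1 - y.1)) * (dyadic k / 2 + (x.1 - y.1)) by apply: mulr_ge0; lra.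
  have : 0 <= (dyadic k - (x.2 - y.2)) * (dyadic k + (x.2 - y.2)) by apply: mulr_ge0; lra.
  by rewrite /D; nra.
have PD : 2 * pi * D <= 10 * dyadic k ^+ 2.
  by apply: (@le_trans _ _ (8 * (5 / 4 * dyadic k ^+ 2))); [apply: ler_pM; lra|lra].
have PD0 : 0 < 2 * pi * D by rewrite !mulr_gt0.
rewrite ler_pdivlMr// mulrC ler_pdivrMr ?mulr_gt0//.
apply: (le_trans PD); nra.
Qed.

Local Notation w n := (omega_n alpha n).
Local Notation f n := (fun x y : R * R => K1 (x.1 - y.1, x.2 - y.2) * w n y).

Let alpha_le1 : alpha <= 1. Proof. by move: alpha_le23; lra. Qed.

Lemma le_u1 n (x : R * R) (c : R) : (4 <= n)%N -> 0 <= x.2 ->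
  (c%:E <= \int[@leb2 R]_y ((EFin \o f n x)^\+ y))%E -> c - pi / 2 <= u1 (w n) x.
Proof.
move=> n4 x0 hc.
have fi := @integrable_biot_savart _ alpha n alpha_ge0 n4 x.
have fneg := @integral_biot_savart_neg_le _ alpha n alpha_ge0 alpha_le1 n4 x x0.
have -> : u1 (w n) x = fine (\int[@leb2 R]_y (f n x y)%:E)%E by rewrite leb2_integralE.
rewrite -lee_fin fineK; last exact: (integrable_fin_num measurableT fi).
by rewrite [leRHS]integralE EFinB leeB.
Qed.

Lemma u1_ge n (x : R * R) : (4 <= n)%N -> 0 <= x.2 -> - (pi / 2) <= u1 (w n) x.
Proof.
by move=> n4 x0; rewrite -sub0r; apply: le_u1 => //; exact: integral_ge0.
Qed.

(** The box index is [m = j + 5], the least value leaving some [k] with [2 <= k <= m - 3]. *)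
Lemma u1_box_ge n j (x : R * R) : (2 ^ j.+3.+3 <= n)%N -> box j.+3.+2 x ->
  (6 * 256 * j.+3.+3%:R `^ alpha)^-1 * j.+3.+3%:R - pi / 2 <= u1 (w n) x.
Proof.
move=> jn Bx.
have n4 : (4 <= n)%N by apply: leq_trans jn; exact: (@leq_pexp2l 2 2).
have [_ _ x20 _] := boxP _ _ Bx.
have qj := dyadic_gt0 j.+3.+2.
apply: le_u1 => //; first by lra.
(* The product of the lower bounds for the kernel and for the vorticity on [box k]. *)
pose c k : R := (64 * dyadic k ^+ 2 * k.+1%:R `^ alpha)^-1.
have c0 k : 0 <= c k by rewrite invr_ge0 mulr_ge0 ?powR_ge0// mulr_ge0// sqr_ge0.
apply: (@le_trans _ _ (\int[@leb2 R]_y (\sum_(2 <= k < j.+3) c k * \1_(box k) y)%:E)%E); last first.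
  apply: le_integralT => y.
  rewrite funeposE/= -EFin_max lee_fin.
  apply: (sum_indic_le _ box c (fun y => Num.max (f n x y) 0)); first exact: box_disj.
  - move=> k z /andP[k2 kj] Bz; rewrite le_max; apply/orP; left.
    have kn : (2 ^ k.+1 <= n)%N.
      by apply: leq_trans jn; rewrite leq_pexp2l//; apply: (leq_trans kj); rewrite 3?leqW.
    have q0 := dyadic_gt0 k.
    have -> : c k = (32 * dyadic k)^-1 * (2 * dyadic k * k.+1%:R `^ alpha)^-1.
      by rewrite /c -invfM; congr _^-1; ring.
    apply: ler_pM.
    + by rewrite invr_ge0 mulr_ge0// ltW.
    + by rewrite invr_ge0 !mulr_ge0 ?powR_ge0// ltW.
    + by apply: K1_box_ge Bx Bz; rewrite !ltnS.
    + exact: omega_n_box_ge.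
  - by move=> z; rewrite le_max lexx orbT.
rewrite (leb2_integral_sum_indic _ _ _ _ _ measurable_box leb2_box c0) lee_fin.
(* Each of the [j + 1] boxes contributes at least this common amount, and [6 (j + 1) >= j + 6],
   whence the factor 6. *)
apply: (@le_trans _ _ (\sum_(2 <= k < j.+3) (256 * j.+3.+3%:R `^ alpha)^-1)).
  rewrite sumr_const_nat subSS -[leRHS]mulr_natr.
  have p0 : 0 < j.+3.+3%:R `^ alpha :> R by rewrite powR_gt0.
  rewrite -[6 * 256 * _]mulrA invfM -[leLHS]mulrA mulrCA ler_pM2l ?invr_gt0 ?mulr_gt0//.
  have -> : j.+3.+3%:R = j%:R + 6 :> R by rewrite -natrD addnC.
  have -> : (j.+2 - 1)%:R = j%:R + 1 :> R by rewrite subn1/= -natr1.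
  by have := ler0n R j; lra.
apply: ler_sum_nat => k /andP[k2 kj].
have q0 := dyadic_gt0 k.
have p0 : 0 < k.+1%:R `^ alpha :> R by rewrite powR_gt0.
have -> : c k * (dyadic k ^+ 2 / 4) = (256 * k.+1%:R `^ alpha)^-1.
  by rewrite /c; field; rewrite !gt_eqF.
rewrite lef_pV2 ?posrE ?mulr_gt0 ?powR_gt0// ler_pM2l// ge0_ler_powR ?nnegrE//.
by rewrite ler_nat ltnS; apply: (leq_trans (ltnW kj)); rewrite 2?leqW.
Qed.

End boxes.

(** * Divergence of the integral *)

Lemma harmonic_tail_unbounded (R : realType) (a : nat) (A : R) :
  exists b : nat, A <= \sum_(a <= m < b) m.+1%:R^-1.
Proof.
have : series (@harmonic R) @ \oo --> +oo.
  apply: nondecreasing_dvgn_lt; last exact: dvg_harmonic.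
  by apply: nondecreasing_series => k _ _; exact: harmonic_ge0.
move=> /cvgryPge/(_ (A + series harmonic a)) h.
have [b [ab hb]] : exists b, (a <= b)%N /\ A + series harmonic a <= series (@harmonic R) b.
  near \oo => b; exists b; split; near: b => //; exact: nbhs_infty_ge.
exists b; rewrite -(lerD2r (series harmonic a)); apply: (le_trans hb).
by rewrite /series/= (big_cat_nat _ ab)//= addrC.
Unshelve. all: by end_near. Qed.

Section divergence.
Context {R : realType}.
Variable alpha : R.
Hypotheses (alpha_gt12 : 2^-1 < alpha) (alpha_le23 : alpha <= 2 / 3).
Local Notation w n := (omega_n alpha n).

Let alpha_ge0 : 0 <= alpha. Proof. by move: alpha_gt12; lra. Qed.
Let alpha_le1 : alpha <= 1. Proof. by move: alpha_le23; lra. Qed.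

(** The case [kappa = 0] of the integrability of [omega_alpha]. The bound is uniform in [n], so the
    loss of [pi / 2] in [u1] costs only a constant. *)
Lemma integral_sqr_omega_n_bounded : exists2 C : R, 0 <= C & forall n, (4 <= n)%N ->
  (\int[@leb2 R]_z (w n z ^+ 2)%:E <= C%:E)%E.
Proof.
have L : in_L2logL 0 (omega_alpha alpha).
  by apply: in_L2logL_omega_alpha => //; move: alpha_gt12; lra.
set I := (\int[@leb2 R]_x (A2k 0 `|omega_alpha alpha x|)%:E)%E.
have I0 : (0 <= I)%E by apply: integral_ge0 => z _; rewrite lee_fin A2k_ge0.
have If : I \is a fin_num by rewrite ge0_fin_numE.
exists (fine I); first exact: fine_ge0.
move=> n n4; rewrite fineK//; apply: leb2_le_integral_off_axis.
- apply/measurable_EFinP; apply: measurable_A2k; apply: measurable_fun_norm.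
  exact: measurable_omega_alpha.
- by move=> z; rewrite lee_fin A2k_ge0.
- move=> z z2; rewrite lee_fin /A2k powRr0 mulr1 ger0_norm ?omega_alpha_ge0//.
  rewrite ler_pXn2r ?nnegrE ?omega_n_ge0 ?omega_alpha_ge0//.
  exact: omega_n_le_alpha.
Qed.

(** On the upper half plane [u1 + pi / 2] is nonnegative, so [(u1 + pi / 2) w^2] can be bounded
    below by its contributions on disjoint boxes; the remaining [pi / 2 * w^2] is controlled by
    [C]. *)
Lemma integral_u1_ge n M (C : R) : (4 <= n)%N -> (2 ^ M <= n)%N ->
  (\int[@leb2 R]_z (w n z ^+ 2)%:E <= C%:E)%E ->
  (((96 * 256)^-1 * \sum_(5 <= m < M) m.+1%:R^-1 - pi / 2 * C)%:E <=
   \int[@leb2 R]_x (u1 (w n) x * `|w n x| ^+ 2)%:E)%E.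
Proof.
move=> n4 Mn hC.
have pi0 : 0 <= pi / 2 :> R by rewrite divr_ge0 ?pi_ge0.
(* The lower bound for [u1 + pi / 2] on [box m] times the square of the one for the vorticity. *)
pose d m : R := (6 * 256 * m.+1%:R `^ alpha)^-1 * m.+1%:R *
  (2 * dyadic m * m.+1%:R `^ alpha)^-1 ^+ 2.
have d0 m : 0 <= d m.
  by rewrite mulr_ge0 ?sqr_ge0// mulr_ge0// invr_ge0 mulr_ge0 ?powR_ge0.
pose S (z : R * R) := \sum_(5 <= m < M) d m * \1_(box m) z.
pose T (z : R * R) := pi / 2 * w n z ^+ 2.
have mw : measurable_fun setT (fun z => w n z ^+ 2).
  by apply: measurable_funX; exact: measurable_omega_n.
have iS : (\int[@leb2 R]_z (S z)%:E = (\sum_(5 <= m < M) d m * (dyadic m ^+ 2 / 4))%:E)%E.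
  exact: (leb2_integral_sum_indic _ _ _ _ _ measurable_box leb2_box d0).
have S0 z : 0 <= S z by apply: sumr_ge0 => m _; rewrite mulr_ge0// indicE.
have T0 z : 0 <= T z by rewrite mulr_ge0// sqr_ge0.
have iT : (\int[@leb2 R]_z (T z)%:E <= (pi / 2 * C)%:E)%E.
  rewrite /T; under eq_integral do rewrite EFinM.
  rewrite ge0_integralZl_EFin//; first by rewrite [leRHS]EFinM lee_wpmul2l.
  - by move=> z _; rewrite lee_fin sqr_ge0.
  - exact/measurable_EFinP.
have integrS : (@leb2 R).-integrable setT (EFin \o S).
  apply/integrableP; split.
    apply/measurable_EFinP; apply: measurable_sum => m.
    by apply: measurable_funM => //; exact: measurable_indic (measurable_box m).
  under eq_integral do rewrite /= ger0_norm//.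
  by rewrite iS ltry.
have integrT : (@leb2 R).-integrable setT (EFin \o T).
  apply/integrableP; split; first by apply/measurable_EFinP; exact: measurable_funM.
  under eq_integral do rewrite /= ger0_norm//.
  exact: le_lt_trans iT (ltry _).
apply: (@le_trans _ _ (\int[@leb2 R]_z ((S z)%:E - (T z)%:E))%E).
  rewrite integralB_EFin// iS EFinB leeB// lee_fin mulr_sumr.
  apply: ler_sum_nat => m _.
  have q0 := dyadic_gt0 (R := R) m.
  have p0 : 0 < m.+1%:R `^ alpha :> R by rewrite powR_gt0.
  have s0 : 0 < m.+1%:R :> R by [].
  (* Here [alpha <= 2/3] enters: box [m] contributes a multiple of [(m+1)^(1 - 3 alpha)], which is
     at least [1/(m+1)]. The constant is [6 * 256] times 4 from the square and 4 from the area. *)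
  have p3 : (m.+1%:R `^ alpha) ^+ 3 <= m.+1%:R ^+ 2 :> R.
    rewrite -!powR_mulrn ?powR_ge0// -powRrM ler_powR ?ler1n//.
    by move: alpha_le23; lra.
  have -> : d m * (dyadic m ^+ 2 / 4) = (96 * 256)^-1 * (m.+1%:R / (m.+1%:R `^ alpha) ^+ 3).
    by rewrite /d; field; rewrite !gt_eqF.
  rewrite ler_pM2l ?invr_gt0// ler_pdivlMr ?exprn_gt0//.
  by rewrite mulrC ler_pdivrMr// -expr2.
apply: le_integralT => x; rewrite -EFinB lee_fin lerBlDr /T ger0_norm ?omega_n_ge0// -mulrDl.
apply: (sum_indic_le _ (@box R) d (fun x => (u1 (w n) x + pi / 2) * w n x ^+ 2)).
- exact: box_disj.
- move=> m y /andP[m5 mM] By.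
  have mn : (2 ^ m.+1 <= n)%N by apply: leq_trans Mn; rewrite leq_pexp2l.
  have u : (6 * 256 * m.+1%:R `^ alpha)^-1 * m.+1%:R <= u1 (w n) y + pi / 2.
    have mE : m = (m - 5).+3.+2 by rewrite -[LHS](subnK m5) addnC.
    by rewrite -lerBlDr; rewrite mE in mn By *; exact: u1_box_ge.
  have q0 := dyadic_gt0 (R := R) m.
  apply: ler_pM => //.
    exact: sqr_ge0.
  have v0 : 0 <= (2 * dyadic m * m.+1%:R `^ alpha)^-1.
    by rewrite invr_ge0 mulr_ge0 ?powR_ge0// mulr_ge0// ltW.
  rewrite ler_pXn2r ?nnegrE ?omega_n_ge0//.
  by apply: omega_n_box_ge => //; exact: leq_trans m5.
- move=> y; have [y0|y0] := ltP y.2 0; first by rewrite /omega_n y0 expr0n mulr0.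
  by rewrite mulr_ge0 ?sqr_ge0// -lerBlDr sub0r u1_ge.
Qed.

Lemma cvg_integral_u1 :
  (fun n : nat => (\int[@leb2 R]_x (u1 (w n) x * `|w n x| ^+ 2)%:E)%E) @ \oo --> +oo%E.
Proof.
have [C C0 hC] := integral_sqr_omega_n_bounded.
apply/cvgeyPge => A.
have [M hM] := @harmonic_tail_unbounded R 5 (96 * 256 * (A + pi / 2 * C)).
near=> n.
have n4 : (4 <= n)%N by near: n; exact: nbhs_infty_ge.
have nM : (2 ^ M <= n)%N by near: n; exact: nbhs_infty_ge.
apply: le_trans (integral_u1_ge _ _ _ n4 nM (hC n n4)).
by rewrite lee_fin lerBrDr ler_pdivlMl.
Unshelve. all: by end_near. Qed.

End divergence.

Theorem theorem5p4 (R : realType) (alpha : R)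
  (halpha1 : 2^-1 < alpha) (halpha2 : alpha <= 2 / 3) :
  (forall kappa : R, 0 <= kappa -> kappa < alpha - 2^-1 ->
     in_L2logL kappa (omega_alpha alpha) /\
     (forall n : nat, (2 <= n)%N -> in_L2logL kappa (omega_n alpha n)) /\
     (fun n : nat => lux_norm kappa (omega_n alpha n \- omega_alpha alpha))
       @ \oo --> 0%E) /\
  (fun n : nat =>
     (\int[@leb2 R]_x (u1 (omega_n alpha n) x * (`|omega_n alpha n x| ^+ 2))%:E)%E)
    @ \oo --> +oo%E.
Proof.
have alpha_le1 : alpha <= 1 by lra.
split; last exact: cvg_integral_u1.
move=> kappa k0 k1; split; [|split].
- exact: in_L2logL_omega_alpha.
- by move=> n; exact: in_L2logL_omega_n.
- exact: lux_norm_cvg0.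
Qed.
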